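(* The complex Cholesky-Jacobi (CJ) method is globally convergent under the class of generalized serial pivot strategies: for every pair $(A,B)$ of $n\times n$ complex Hermitian matrices with $B$ positive definite and every cyclic pivot strategy $I_{\mathcal{O}}$ with $\mathcal{O}\in\mathcal{C}_{sg}^{(n)}$, the sequences generated by the CJ method satisfy $A^{(k)}\to\Lambda$ and $B^{(k)}\to I_n$ as $k\to\infty$, where $\Lambda$ is a diagonal matrix of the eigenvalues of $(A,B)$.
   Context: Positive definite generalized eigenvalue problem: $Ax=\lambda Bx$, $x\ne0$, with $A,B\in\mathbb{C}^{n\times n}$ Hermitian, $B$ positive definite. $\imath=\sqrt{-1}$. The CJ method: first set $A^{(0)}=DAD$, $B^{(0)}=DBD$ with $D=\mathrm{diag}(b_{11}^{-1/2},\dots,b_{nn}^{-1/2})$, so $B^{(0)}$ has unit diagonal. Then for $k\ge0$, with pivot pair $(i,j)=(i(k),j(k))$, $i<j$, set $A^{(k+1)}=Z_k^*A^{(k)}Z_k$, $B^{(k+1)}=Z_k^*B^{(k)}Z_k$, where $Z_k$ equals $I_n$ except for its pivot submatrix (rows/columns $i,j$) $\hat Z_k=\hat C\hat J$ defined as follows. Write $a_{rs}=a^{(k)}_{rs}$, $b=b^{(k)}_{ij}$ and $\beta=\sqrt{1-|b|^2}$. If $a_{ii}\le a_{jj}$, $\hat C=\frac1\beta\begin{bmatrix}\beta&-b\\0&1\end{bmatrix}$ (inverse conjugate transpose of the Cholesky factor $\hat L$ of $\hat B=\hat L\hat L^*$, $\hat L$ lower triangular); if $a_{ii}>a_{jj}$,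 $\hat C=\frac1\beta\begin{bmatrix}1&0\\-\bar b&\beta\end{bmatrix}$ (from $\hat B=\hat R\hat R^*$, $\hat R$ upper triangular). Let $M=\hat C^*\hat A\hat C=(m_{rs})_{r,s=1}^2$ where $\hat A$ is the pivot submatrix of $A^{(k)}$. Then $\hat J=\begin{bmatrix}\cos\phi&-e^{\imath\alpha}\sin\phi\\ e^{-\imath\alpha}\sin\phi&\cos\phi\end{bmatrix}$ with $\alpha=\arg(m_{12})$ and $\phi\in[-\pi/4,\pi/4]$ satisfying $\tan(2\phi)=2|m_{12}|/(m_{11}-m_{22})$, chosen as $\phi=0$ when $m_{12}=0$ and $m_{11}=m_{22}$; thus $\hat J^*M\hat J$ is diagonal, and the pivot submatrix of $B^{(k+1)}$ is $I_2$. Pivot strategies: $\mathcal{P}_n=\{(r,s):1\le r<s\le n\}$, $N=n(n-1)/2$; an ordering is a sequence listing each element of $\mathcal{P}_n$ exactly once; for an ordering $\mathcal{O}=(i_0,j_0),\dots,(i_{N-1},j_{N-1})$, the cyclic strategy is $I_{\mathcal{O}}(k)=(i_{k\bmod N},j_{k\bmod N})$. An admissible transposition swaps two adjacent pairs with disjoint index sets; $\mathcal{O}\sim\mathcal{O}'$ if related by finitely many admissible transpositions; $\mathcal{O}\stackrel{\mathsf{s}}{\sim}\mathcal{O}'$ if $\mathcal{O}=[\mathcal{O}_1,\mathcal{O}_2]$, $\mathcal{O}'=[\mathcal{O}_2,\mathcal{O}_1]$; $\mathcal{O}\stackrel{\mathsf{w}}{\sim}\mathcal{O}'$ if there is a chain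 of orderings from $\mathcal{O}$ to $\mathcal{O}'$ with adjacent terms $\sim$ or $\stackrel{\mathsf{s}}{\sim}$, in canonical form if these alternate; $\mathcal{O}\stackrel{\mathsf{p}}{\sim}\mathcal{O}'$ if for a permutation $\mathsf{q}$ of $\{1,\dots,n\}$, $\mathcal{O}'$ arises by replacing each pair $(i_k,j_k)$ by the pair with entries $\mathsf{q}(i_k),\mathsf{q}(j_k)$ in increasing order. $\mathcal{C}_c^{(n)}$: orderings $(1,2),(\tau_3(1),3),(\tau_3(2),3),\dots,(\tau_n(1),n),\dots,(\tau_n(n-1),n)$, $\tau_j$ a permutation of $\{1,\dots,j-1\}$; $\mathcal{C}_r^{(n)}$: orderings $(n-1,n),(n-2,\tau_{n-2}(n-1)),(n-2,\tau_{n-2}(n)),\dots,(1,\tau_1(2)),\dots,(1,\tau_1(n))$, $\tau_i$ a permutation of $\{i+1,\dots,n\}$; $\overleftarrow{\mathcal{C}}_c^{(n)},\overleftarrow{\mathcal{C}}_r^{(n)}$ the sets of orderings whose reversed sequences lie in $\mathcal{C}_c^{(n)}$, $\mathcal{C}_r^{(n)}$; $\mathcal{C}_{sp}^{(n)}$ the union of these four sets. $\mathcal{C}_{sg}^{(n)}$ is the set of orderings $\mathcal{O}$ with $\mathcal{O}\stackrel{\mathsf{p}}{\sim}\mathcal{O}'\stackrel{\mathsf{w}}{\sim}\mathcal{O}''$ or $\mathcal{O}\stackrel{\mathsf{w}}{\sim}\mathcal{O}'\stackrel{\mathsf{p}}{\sim}\mathcal{O}''$ for some ordering $\mathcal{O}'$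 and some $\mathcal{O}''\in\mathcal{C}_{sp}^{(n)}$, weak equivalence in canonical form. *)

(* Defs.v *)
(* complex numbers are R[i] (mathcomp-real-closed) over an
   arbitrary realType R (mathcomp-analysis), whose trigonometric functions
   (atan, cos, sin, pi) are used for the Jacobi rotation angle. *)
From mathcomp Require Import all_boot all_order all_algebra all_fingroup.
From mathcomp Require Import reals trigo.
From mathcomp Require Import complex.
From Stdlib Require Import Relation_Operators.
Set Implicit Arguments. Unset Strict Implicit. Unset Printing Implicit Defensive.
Import Order.TTheory GRing.Theory Num.Theory.
Local Open Scope ring_scope.

Section CJ.
Variable R : realType.
Local Notation C := R[i].
Variable n : nat.

(** conjugate transpose *)
Definition ctrmx m p (M : 'M[C]_(m, p)) : 'M[C]_(p, m) :=
  \matrix_(r, s) (M s r)^*.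

Definition herm_mx (A : 'M[C]_n) : Prop := ctrmx A = A.

Definition posdef_mx (B : 'M[C]_n) : Prop :=
  forall x : 'cV[C]_n, x != 0 -> 0 < (ctrmx x *m B *m x) ord0 ord0.

(** 2x2 matrices *)
Definition c0 : 'I_2 := ord0.
Definition c1 : 'I_2 := ord_max.
Definition mx2 (a b c d : C) : 'M[C]_2 :=
  \matrix_(r < 2, s < 2)
    if r == c0 then (if s == c0 then a else b) else (if s == c0 then c else d).

(** pivot submatrix of M at rows/columns i, j *)
Definition pivsub (M : 'M[C]_n) (i j : 'I_n) : 'M[C]_2 :=
  mx2 (M i i) (M i j) (M j i) (M j j).

(** Z = I_n except pivot submatrix Zh at rows/columns i, j (i <> j) *)
Definition embed2 (Zh : 'M[C]_2) (i j : 'I_n) : 'M[C]_n :=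
  \matrix_(r, s)
    if r == i then (if s == i then Zh c0 c0 else if s == j then Zh c0 c1 else 0)
    else if r == j then (if s == i then Zh c1 c0 else if s == j then Zh c1 c1 else 0)
    else (r == s)%:R.

(** initial scaling D = diag(b_11^{-1/2}, ..., b_nn^{-1/2}) *)
Definition scaleD (B : 'M[C]_n) : 'M[C]_n :=
  diag_mx (\row_(r < n) (sqrtC (B r r))^-1).

(** the factor C-hat of the CJ step *)
Definition Chat (A B : 'M[C]_n) (i j : 'I_n) : 'M[C]_2 :=
  let b := B i j in
  let beta := sqrtC (1 - `|b| ^+ 2) in
  if A i i <= A j j then beta^-1 *: mx2 beta (- b) 0 1
  else beta^-1 *: mx2 1 0 (- b^*) beta.

(** the rotation angle phi in [-pi/4, pi/4] with
    tan (2 phi) = 2 |m12| / (m11 - m22);  phi = 0 if m12 = 0 and m11 = m22;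
    phi = pi/4 if m11 = m22 and m12 <> 0 (tan (2 phi) = +infinity). *)
Definition jac_phi (M : 'M[C]_2) : R :=
  let d := complex.Re (M c0 c0 - M c1 c1) in
  let r := complex.Re `|M c0 c1| in
  if d != 0 then atan (2 * r / d) / 2
  else if M c0 c1 == 0 then 0 else pi / 4.

(** e^{i alpha} with alpha = arg(m12); arg 0 := 0 *)
Definition jac_eia (M : 'M[C]_2) : C :=
  if M c0 c1 == 0 then 1 else M c0 c1 / `|M c0 c1|.

Definition Jhat (M : 'M[C]_2) : 'M[C]_2 :=
  let cs := ((cos (jac_phi M))%:C)%C in
  let sn := ((sin (jac_phi M))%:C)%C in
  let e := jac_eia M in
  mx2 cs (- e * sn) (e^* * sn) cs.

(** one CJ step with pivot pair (i, j) *)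
Definition cj_Z (A B : 'M[C]_n) (i j : 'I_n) : 'M[C]_n :=
  let Ch := Chat A B i j in
  let M := ctrmx Ch *m pivsub A i j *m Ch in
  embed2 (Ch *m Jhat M) i j.

Definition cj_step (AB : 'M[C]_n * 'M[C]_n) (p : 'I_n * 'I_n)
    : 'M[C]_n * 'M[C]_n :=
  let Z := cj_Z AB.1 AB.2 p.1 p.2 in
  (ctrmx Z *m AB.1 *m Z, ctrmx Z *m AB.2 *m Z).

(** the CJ sequence (A^(k), B^(k)) for a pivot strategy piv *)
Fixpoint cj_seq (A B : 'M[C]_n) (piv : nat -> 'I_n * 'I_n) (k : nat)
    : 'M[C]_n * 'M[C]_n :=
  match k with
  | 0 => (scaleD B *m A *m scaleD B, scaleD B *m B *m scaleD B)
  | k'.+1 => cj_step (cj_seq A B piv k') (piv k')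
  end.

(** entrywise convergence of a sequence of matrices *)
Definition mx_cvg (M : nat -> 'M[C]_n) (L : 'M[C]_n) : Prop :=
  forall e : R, 0 < e -> exists N : nat, forall k : nat, (N <= k)%N ->
    forall r s : 'I_n, `|M k r s - L r s| < ((e%:C)%C).

(** d lists the eigenvalues of the pencil (A, B) with algebraic multiplicity:
    det(x B - A) = det(B) * prod_i (x - d_i) *)
Definition pencil_eigs (A B : 'M[C]_n) (d : 'rV[C]_n) : Prop :=
  \det ('X *: map_mx polyC B - map_mx polyC A)
  = \det B *: \prod_(r < n) ('X - (d ord0 r)%:P).

End CJ.

(** ---------------- pivot orderings (0-based indices) ---------------- *)
Section Orderings.
Variable n : nat.
Local Notation pair := ('I_n * 'I_n)%type.

(** P_n as a list *)
Definition all_pairs : seq pair :=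
  flatten [seq [seq (i, j) | j <- [seq j : 'I_n <- enum 'I_n | (i < j)%N]]
          | i : 'I_n <- enum 'I_n].

Definition is_ordering (O : seq pair) : bool := perm_eq O all_pairs.

Definition Npairs : nat := (n * (n - 1)) %/ 2.

(** cyclic strategy I_O(k) = (i_{k mod N}, j_{k mod N}) *)
Definition cyc_strategy (O : seq pair) (dflt : pair) (k : nat) : pair :=
  nth dflt O (k %% Npairs).

Definition disjoint_pairs (p q : pair) : bool :=
  [&& p.1 != q.1, p.1 != q.2, p.2 != q.1 & p.2 != q.2].

(** admissible transposition *)
Definition adm_transp (O O' : seq pair) : Prop :=
  exists (s1 s2 : seq pair) (p q : pair),
    O = s1 ++ p :: q :: s2 /\ O' = s1 ++ q :: p :: s2 /\ disjoint_pairs p q.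

(** O ~ O' *)
Definition equiv_ord : seq pair -> seq pair -> Prop :=
  clos_refl_trans (seq pair) adm_transp.

(** O ~s O' *)
Definition shift_equiv (O O' : seq pair) : Prop :=
  exists O1 O2 : seq pair, O = O1 ++ O2 /\ O' = O2 ++ O1.

(** O ~w O' : chain with adjacent terms ~ or ~s *)
Definition weak_equiv : seq pair -> seq pair -> Prop :=
  clos_refl_trans (seq pair) (fun O O' => equiv_ord O O' \/ shift_equiv O O').

(** O ~p O' *)
Definition perm_pair (q : {perm 'I_n}) (p : pair) : pair :=
  if (q p.1 < q p.2)%N then (q p.1, q p.2) else (q p.2, q p.1).

Definition perm_equiv (O O' : seq pair) : Prop :=
  exists q : {perm 'I_n}, O' = map (perm_pair q) O.

(** column-cyclic orderings C_c^(n) *)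
Definition C_c (O : seq pair) : Prop :=
  is_ordering O /\
  exists tau : 'I_n -> seq 'I_n,
    (forall j, perm_eq (tau j) [seq i : 'I_n <- enum 'I_n | (i < j)%N]) /\
    O = flatten [seq [seq (i, j) | i <- tau j] | j <- enum 'I_n].

(** row-cyclic orderings C_r^(n) *)
Definition C_r (O : seq pair) : Prop :=
  is_ordering O /\
  exists tau : 'I_n -> seq 'I_n,
    (forall i, perm_eq (tau i) [seq j : 'I_n <- enum 'I_n | (i < j)%N]) /\
    O = flatten [seq [seq (i, j) | j <- tau i] | i <- rev (enum 'I_n)].

Definition C_sp (O : seq pair) : Prop :=
  C_c O \/ C_r O \/ C_c (rev O) \/ C_r (rev O).

(** generalized serial orderings C_sg^(n) *)
Definition C_sg (O : seq pair) : Prop :=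
  is_ordering O /\
  exists O' O'' : seq pair, C_sp O'' /\
    ((perm_equiv O O' /\ weak_equiv O' O'') \/
     (weak_equiv O O' /\ perm_equiv O' O'')).

End Orderings.

(* Main.v *)
(** The matrix [B] is normalised to have a unit diagonal, and [|det B_k|] grows by
    the factor [1 / (1 - |b_k|^2)] at each step while remaining bounded, so the
    pivots [b_k] tend to 0 and each step becomes asymptotically a plane rotation
    whose diagonal entries are bounded away from 0.  For such a process the
    off-diagonal parts of [A_k] and [B_k] tend to 0: otherwise limits along an
    ultrafilter would yield an exact Jacobi process on a non-diagonal Hermitian
    matrix that never loses off-norm, i.e. all of whose pivots already vanish.
    Along a serial ordering such a process starts from a diagonal matrix; this
    property of a word of pivots survives time reversal, relabelling, commutation
    of disjoint pairs and extension, and a shift costs one more cycle, hence it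
    holds for some power of every generalized serial ordering.  Finally the
    diagonal entries of [A_k] approach the finite set of roots of the pencil by
    steps tending to 0 (this uses [|phi| <= pi/4]), so each of them converges. *)
Require Import Defs.
From mathcomp Require Import all_boot all_order all_algebra all_fingroup.
From mathcomp Require Import boolp classical_sets filter reals trigo.
From mathcomp Require Import complex ring lra zify.
From Stdlib Require Import Relation_Operators.
Set Implicit Arguments. Unset Strict Implicit. Unset Printing Implicit Defensive.
Import Order.TTheory GRing.Theory Num.Theory.
Local Open Scope ring_scope.

(** * Plane rotations acting by congruence *)

(** The rotation angle is a discontinuous function of the matrix: near a zero pivot with equal
    diagonal entries, neighbouring matrices may be rotated by very different angles. A limit of
    steps is therefore in general not the step computed at the limit matrix, and [run] keeps only
    what survives the limit: a unitary in the pivot plane, nonzero diagonal entries of it, and a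
    zero pivot before and after. The bound |phi| <= pi/4 enters as cos^2 phi >= 1/2, and is used
    twice: it keeps coordinate exchanges out of the limit process, and it bounds the change of the
    diagonal by the size of the pivot.

    The factor of a step is unitary only asymptotically, so the off-norm need not decrease; this is
    why its limit superior is followed instead of a monotone limit. The convergence theorem is
    stated for an abstract sequence [H] because it is applied twice with the same rotations: to A_k,
    whose pivot is annihilated by the Jacobi rotation, and to B_k, whose pivot block becomes the
    identity. *)

Section ConjugateTranspose.
Variable R : realType.
Local Notation C := R[i].

Lemma ctrmxE m p (M : 'M[C]_(m, p)) r s : ctrmx M r s = (M s r)^*.
Proof. by rewrite mxE. Qed.

Lemma ctrmxK m p (M : 'M[C]_(m, p)) : ctrmx (ctrmx M) = M.
Proof. by apply/matrixP=> r s; rewrite !ctrmxE conjCK. Qed.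

Lemma ctrmx_mul m p q (M : 'M[C]_(m, p)) (N : 'M[C]_(p, q)) :
  ctrmx (M *m N) = ctrmx N *m ctrmx M.
Proof.
apply/matrixP=> r s; rewrite ctrmxE !mxE rmorph_sum /=.
by apply: eq_bigr => k _; rewrite rmorphM !ctrmxE mulrC.
Qed.

Lemma ctrmx1 m : ctrmx (1%:M : 'M[C]_m) = 1%:M.
Proof. by apply/matrixP=> r s; rewrite ctrmxE !mxE conjC_nat eq_sym. Qed.

Lemma det_ctrmx m (M : 'M[C]_m) : \det (ctrmx M) = (\det M)^*.
Proof.
have -> : ctrmx M = map_mx (Num.conj : C -> C) M^T by apply/matrixP=> r s; rewrite !mxE.
by rewrite det_map_mx det_tr.
Qed.

End ConjugateTranspose.

Section Exact.
Variables (R : realType) (n : nat).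
Local Notation C := R[i].
Local Notation pair := ('I_n * 'I_n)%type.

Definition cong (U h : 'M[C]_n) : 'M[C]_n := ctrmx U *m h *m U.

Lemma cong_mul U V h : cong V (cong U h) = cong (U *m V) h.
Proof. by rewrite /cong ctrmx_mul !mulmxA. Qed.

Lemma cong1 h : cong 1%:M h = h.
Proof. by rewrite /cong ctrmx1 mul1mx mulmx1. Qed.

Lemma herm_cong U h : herm_mx h -> herm_mx (cong U h).
Proof.
by rewrite /herm_mx /cong !ctrmx_mul ctrmxK mulmxA => ->.
Qed.

Lemma hermE (h : 'M[C]_n) r s : herm_mx h -> h s r = (h r s)^*.
Proof. by move=> hh; rewrite -[in LHS]hh ctrmxE. Qed.

Lemma herm_eq0 (h : 'M[C]_n) r s : herm_mx h -> h r s = 0 -> h s r = 0.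
Proof. by move=> hh h0; rewrite (hermE r s hh) h0 rmorph0. Qed.

Definition outside (p : pair) (r : 'I_n) := (r != p.1) && (r != p.2).

Definition plane_mx (p : pair) (U : 'M[C]_n) : Prop :=
  forall r s, outside p r || outside p s -> U r s = (r == s)%:R.

Definition plane_unitary (p : pair) (U : 'M[C]_n) : Prop :=
  ctrmx U *m U = 1%:M /\ plane_mx p U.

(** The nonzero diagonal entries exclude coordinate exchanges. With exchanges, a single nonzero
    entry at (1,3) could escape the pivots (1,2), (1,3), (2,3) forever, moving to (2,3), then to
    (1,2), then back to (1,3). Both entries are required so that the notion is unchanged when a pair
    is reversed. *)
Definition plane_rot (p : pair) (U : 'M[C]_n) : Prop :=
  [/\ p.1 != p.2, plane_unitary p U, U p.1 p.1 != 0 & U p.2 p.2 != 0].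

Lemma plane_unitary_ctr p U : plane_unitary p U -> plane_unitary p (ctrmx U).
Proof.
case=> UU Uo; split; first by rewrite ctrmxK mulmx1C.
by move=> r s o; rewrite ctrmxE Uo ?conjC_nat 1?eq_sym // orbC.
Qed.

Lemma plane_rot_ctr p U : plane_rot p U -> plane_rot p (ctrmx U).
Proof.
case=> np UU U1 U2; split; rewrite ?ctrmxE ?conjC_eq0 //.
exact: plane_unitary_ctr.
Qed.

Lemma cong_ctrK p U h : plane_unitary p U -> cong (ctrmx U) (cong U h) = h.
Proof. by case=> UU _; rewrite cong_mul mulmx1C // cong1. Qed.

Lemma cong_row p U h r s : plane_mx p U -> outside p r ->
  cong U h r s = (h *m U) r s.
Proof.
move=> Uo or; rewrite /cong -mulmxA mxE (bigD1 r) //= ctrmxE Uo ?or //.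
rewrite eqxx conjC_nat mul1r big1 ?addr0 // => k kr.
by rewrite ctrmxE Uo ?or ?orbT // (negbTE kr) conjC_nat mul0r.
Qed.

Lemma cong_out p U h r s : plane_mx p U -> outside p r -> outside p s ->
  cong U h r s = h r s.
Proof.
move=> Uo or os; rewrite (cong_row _ _ Uo) // mxE.
rewrite (bigD1 s) //= Uo ?os ?orbT // eqxx mulr1.
by rewrite big1 ?addr0 // => k ks; rewrite Uo ?os ?orbT // (negbTE ks) mulr0.
Qed.

Lemma cong_mix p U h r s : p.1 != p.2 -> plane_unitary p U -> outside p r ->
  ~~ outside p s -> cong U h r s = h r p.1 * U p.1 s + h r p.2 * U p.2 s.
Proof.
move=> np pU or os; rewrite (cong_row _ _ (proj2 pU)) // mxE.
case: pU => _ Uo; rewrite (bigD1 p.1) //= (bigD1 p.2) ?[p.2 == _]eq_sym //=.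
rewrite big1 ?addr0 // => k /andP[k1 k2].
have ok : outside p k by rewrite /outside k1.
rewrite Uo ?ok //; case: eqP => [e|_]; last by rewrite mulr0.
by rewrite -e ok in os.
Qed.

Definition offzero (h : 'M[C]_n) := forall r s, r != s -> h r s = 0.

Lemma outsideN p r : ~~ outside p r -> r = p.1 \/ r = p.2.
Proof. by rewrite /outside negb_and !negbK => /orP[] /eqP; [left|right]. Qed.

(** Entries with exactly one index in the pivot plane become combinations of two zeros. The pivot
    entry is not automatic, because the two diagonal entries may differ; hence the hypothesis on
    it. *)
Lemma offzero_cong p U h : p.1 != p.2 -> plane_unitary p U -> herm_mx h ->
  cong U h p.1 p.2 = 0 -> offzero h -> offzero (cong U h).
Proof.
move=> np pU hh h'0 h0.
have mix r s : outside p r -> ~~ outside p s -> cong U h r s = 0.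
  move=> or os; rewrite (cong_mix _ np pU) //.
  by move: or => /andP[r1 r2]; rewrite !h0 // !mul0r addr0.
have hh' := herm_cong U hh.
move=> r s rs; case: (boolP (outside p r)) => or; case: (boolP (outside p s)) => os.
- by rewrite (cong_out _ (proj2 pU)) // h0.
- exact: mix.
- by apply: herm_eq0 => //; apply: mix.
- move: rs; case: (outsideN or) => ->; case: (outsideN os) => ->; rewrite ?eqxx // => _.
  by apply: herm_eq0.
Qed.

(** A process along the word [s] during which no rotation decreases the
    off-diagonal part, since every pivot is already zero. *)
Fixpoint run (s : seq pair) (h g : 'M[C]_n) : Prop :=
  if s is p :: s' then
    exists U, [/\ plane_rot p U, h p.1 p.2 = 0, cong U h p.1 p.2 = 0 &
                  run s' (cong U h) g]
  else h = g.

Lemma run_cat s t h g : run (s ++ t) h g <-> exists2 f, run s h f & run t f g.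
Proof.
elim: s h => [|p s IH] h /=; first by split=> [r|[f ->]]; first by exists h.
split.
  case=> U [pU h0 h1] /IH[f r1 r2]; exists f => //.
  by exists U.
by case=> f [U [pU h0 h1 r1]] r2; exists U; split=> //; apply/IH; exists f.
Qed.

Lemma run_herm s h g : run s h g -> herm_mx h -> herm_mx g.
Proof.
elim: s h => [|p s IH] h /=; first by move->.
by case=> U [_ _ _ r] hh; apply: (IH _ r); apply: herm_cong.
Qed.

(** The pivot is zero both before and after each rotation, so undoing the rotations with [ctrmx U]
    is again a process of the same kind. *)
Lemma run_rev s h g : run s h g -> run (rev s) g h.
Proof.
elim: s h => [|p s IH] h /=; first by move->.
case=> U [pU h0 h1 /IH r]; rewrite rev_cons -cats1; apply/run_cat.
exists (cong U h) => //=; exists (ctrmx U).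
have [_ pu _ _] := pU.
rewrite (cong_ctrK _ pu); split=> //; exact: plane_rot_ctr.
Qed.

Lemma run_offzero s h g : herm_mx h -> run s h g -> offzero h -> offzero g.
Proof.
elim: s h => [|p s IH] h /=; first by move=> _ ->.
move=> hh [U [[np pU _ _] h0 h1 r]] o; apply: (IH _ _ r).
  exact: herm_cong.
exact: offzero_cong np pU _ _ _.
Qed.

Lemma run_offzero_rev s h g : herm_mx h -> run s h g -> offzero g -> offzero h.
Proof.
move=> hh r; apply: (run_offzero _ (run_rev r)); exact: run_herm r hh.
Qed.

(** Diagonality travels along a run in both directions, so a statement about the initial matrix
    settles every later one as well; extension and reversal of words rest on this. *)
Definition forcing (s : seq pair) : Prop :=
  forall h g, herm_mx h -> run s h g -> offzero h.

Lemma forcing_infix s1 s s2 : forcing s -> forcing (s1 ++ s ++ s2).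
Proof.
move=> fs h g hh /run_cat[f r /run_cat[f' r' _]].
apply: (run_offzero_rev hh r); apply: fs r'; exact: run_herm r hh.
Qed.

Lemma forcing_rev s : forcing (rev s) -> forcing s.
Proof.
move=> fs h g hh r; apply: (run_offzero_rev hh r).
by apply: fs (run_rev r); apply: run_herm r hh.
Qed.

Lemma disjoint_outside p q : disjoint_pairs p q ->
  [/\ outside p q.1, outside p q.2, outside q p.1 & outside q p.2].
Proof.
by case/and4P=> a b c d; rewrite /outside ![q.1 == _]eq_sym ![q.2 == _]eq_sym a b c d.
Qed.

(** [U - 1] is supported on the indices of [p] and [V - 1] on those of [q]. Since the product
    vanishes in either order, [U V = U + V - 1 = V U]. *)
Lemma plane_sub1_mul0 p q U V : disjoint_pairs p q ->
  plane_unitary p U -> plane_unitary q V -> (U - 1%:M) *m (V - 1%:M) = 0.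
Proof.
move=> dpq [_ Uo] [_ Vo].
have [_ _ c d] := disjoint_outside dpq.
apply/matrixP=> r s; rewrite !mxE big1 // => k _.
case: (boolP (outside p k)) => [ok|/outsideN kp].
  by rewrite !mxE Uo ?ok ?orbT // subrr mul0r.
have ok : outside q k by case: kp => ->.
by rewrite !mxE Vo ?ok // subrr mulr0.
Qed.

Lemma plane_comm p q U V : disjoint_pairs p q ->
  plane_unitary p U -> plane_unitary q V -> U *m V = V *m U.
Proof.
move=> dpq pU qV.
have dqp : disjoint_pairs q p.
  by case/and4P: dpq => *; apply/and4P; split; rewrite eq_sym.
have E (W X : 'M[C]_n) : (W - 1%:M) *m (X - 1%:M) = W *m X - (W + X - 1%:M).
  rewrite mulmxBl !mulmxBr !mul1mx mulmx1 opprB -addrA; congr (_ + _).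
  by apply/matrixP=> r s; rewrite !mxE; ring.
have := plane_sub1_mul0 dqp qV pU; rewrite -(plane_sub1_mul0 dpq pU qV) !E.
by rewrite [V + U]addrC => /addIr.
Qed.

(** A rotation in one plane leaves the pivot entry of the other plane untouched, so the zeros
    required before and after each step persist when the two commuting steps are exchanged. *)
Lemma run_swap p q s h g : disjoint_pairs p q ->
  run [:: p, q & s] h g -> run [:: q, p & s] h g.
Proof.
move=> dpq /= [U [[np pU U1 U2] h0 h1 [V [[nq qV V1 V2] g0 g1 r]]]].
have [a b c d] := disjoint_outside dpq.
rewrite (cong_out _ (proj2 pU)) // in g0.
have e : cong V (cong U h) = cong U (cong V h).
  by rewrite !cong_mul (plane_comm dpq pU qV).
exists V; split=> //.
  by rewrite e (cong_out _ (proj2 pU)) in g1.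
exists U; split=> //.
- by rewrite (cong_out _ (proj2 qV)).
- by rewrite -e (cong_out _ (proj2 qV)).
- by rewrite -e.
Qed.

Lemma forcing_adm s t : adm_transp s t -> forcing t -> forcing s.
Proof.
case=> s1 [s2 [p [q [-> [-> d]]]]] ft h g hh /run_cat[f r1 r2].
by apply: (ft h g hh); apply/run_cat; exists f => //; apply: run_swap.
Qed.

(** Conjugation by the permutation matrix of [q]. [perm_pair] may reverse a pair to restore
    increasing order, which a Hermitian zero entry does not notice. *)
Definition relabel (q : {perm 'I_n}) (M : 'M[C]_n) : 'M[C]_n :=
  \matrix_(r, s) M (q^-1%g r) (q^-1%g s).

Lemma relabel_mul q M N : relabel q (M *m N) = relabel q M *m relabel q N.
Proof.
apply/matrixP=> r s; rewrite !mxE (reindex_inj (@perm_inj _ q^-1%g)) /=.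
by apply: eq_bigr => k _; rewrite !mxE.
Qed.

Lemma relabel_ctr q M : relabel q (ctrmx M) = ctrmx (relabel q M).
Proof. by apply/matrixP=> r s; rewrite !mxE. Qed.

Lemma relabel_cong q U h : relabel q (cong U h) = cong (relabel q U) (relabel q h).
Proof. by rewrite /cong !relabel_mul relabel_ctr. Qed.

Lemma relabelE q M r s : relabel q M (q r) (q s) = M r s.
Proof. by rewrite mxE !permK. Qed.

Lemma perm_pairP (q : {perm 'I_n}) (p : pair) :
  perm_pair q p = (q p.1, q p.2) \/ perm_pair q p = (q p.2, q p.1).
Proof. by rewrite /perm_pair; case: ifP; [left|right]. Qed.

Lemma outside_perm (q : {perm 'I_n}) p r : outside (perm_pair q p) (q r) = outside p r.
Proof.
case: (perm_pairP q p) => ->; rewrite /outside /= !(inj_eq perm_inj) //.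
by rewrite andbC.
Qed.

Lemma relabel_plane q p U : plane_rot p U -> plane_rot (perm_pair q p) (relabel q U).
Proof.
case=> np [UU Uo] U1 U2; have pu : plane_unitary (perm_pair q p) (relabel q U).
  split.
    rewrite -relabel_ctr -relabel_mul UU; apply/matrixP=> r s; rewrite !mxE.
    by rewrite (inj_eq perm_inj).
  move=> r s; rewrite -[r](permKV q) -[s](permKV q) !outside_perm relabelE.
  by rewrite (inj_eq perm_inj); apply: Uo.
split=> //; case: (perm_pairP q p) => ->; rewrite /= ?relabelE ?(inj_eq perm_inj) //.
by rewrite eq_sym.
Qed.

Lemma relabel_herm q h : herm_mx h -> herm_mx (relabel q h).
Proof. by rewrite /herm_mx -relabel_ctr => ->. Qed.

Lemma relabel_pivot q p h : herm_mx h -> h p.1 p.2 = 0 ->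
  relabel q h (perm_pair q p).1 (perm_pair q p).2 = 0.
Proof.
move=> hh h0; case: (perm_pairP q p) => ->; rewrite /= relabelE //.
exact: herm_eq0.
Qed.

Lemma run_relabel q s h g : herm_mx h -> run s h g ->
  run (map (perm_pair q) s) (relabel q h) (relabel q g).
Proof.
elim: s h => [|p s IH] h hh /=; first by move->.
case=> U [pU h0 h1 r]; exists (relabel q U).
have hh' := herm_cong U hh.
split; rewrite -?relabel_cong.
- exact: relabel_plane.
- exact: relabel_pivot.
- exact: relabel_pivot.
- exact: IH.
Qed.

Lemma forcing_perm q s : forcing (map (perm_pair q) s) -> forcing s.
Proof.
move=> fs h g hh r i j ij; rewrite -(relabelE q).
apply: fs (relabel_herm _ hh) (run_relabel _ hh r) _ _ _.
by rewrite (inj_eq perm_inj).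
Qed.

(** * Serial words *)

(** One argument serves both serial families: [b = true] gives the pairs of column [j], [b = false]
    those of row [j]. *)
Definition star (b : bool) (j i : 'I_n) : pair := if b then (i, j) else (j, i).

Definition block_zero (S : {pred 'I_n}) (h : 'M[C]_n) :=
  forall r s, r \in S -> s \in S -> r != s -> h r s = 0.

(* Inside the block of column [j], rotating with [d] makes [h r d] proportional
   to [h r j]; this entry is only known to vanish when the pivot [(r, j)] is
   reached, hence the implication in the second hypothesis. *)
Lemma run_star b j (t : seq 'I_n) (D : {pred 'I_n}) h g :
  herm_mx h -> uniq t -> j \notin t -> j \notin D -> (forall r, r \in t -> r \notin D) ->
  (forall r s, r \in t -> s \in t -> r != s -> h r s = 0) ->
  (forall r, r \in t -> h r j = 0 -> forall d, d \in D -> h r d = 0) ->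
  block_zero [predU1 j & D] h ->
  run (map (star b j) t) h g ->
  block_zero [predU1 j & [predU (mem t) & D]] g.
Proof.
elim: t D h => [|d0 t IH] D h hh /=.
  move=> _ _ _ _ _ _ bz <- r s; rewrite !inE /= => rP sP; exact: bz.
case/andP=> d0t ut; rewrite !inE negb_or => /andP[jd0 jt] jD tD H1 H2 H3.
case=> U [pU h0 h1 r].
have d0D : d0 \notin D by apply: tD; rewrite inE eqxx.
have hh' := herm_cong U hh.
have oE k : outside (star b j d0) k = (k != d0) && (k != j).
  by rewrite /outside /star; case: b {IH h0 h1 r pU} => //=; rewrite andbC.
have {}h0 : h d0 j = 0 by move: h0; rewrite /star; case: b {IH h1 r pU oE} => //= /herm_eq0; apply.
have {}h1 : cong U h d0 j = 0.
  by move: h1; rewrite /star; case: b {IH r pU oE} => //= /herm_eq0; apply.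
have [np pu Uj] : [/\ (star b j d0).1 != (star b j d0).2,
     plane_unitary (star b j d0) U & U j j != 0].
  by move: pU; rewrite /plane_rot /star; case: b {IH r oE} => -[]; split.
have mix k s : k != d0 -> k != j -> (s == d0) || (s == j) ->
    cong U h k s = h k d0 * U d0 s + h k j * U j s.
  move=> kd kj sP; rewrite (cong_mix _ np pu) ?oE ?kd ?kj //; last first.
    by rewrite negb_and !negbK.
  by rewrite /star; case: b {IH r pU oE np pu} => //=; rewrite addrC.
have out k s : k != d0 -> k != j -> s != d0 -> s != j -> cong U h k s = h k s.
  by move=> *; rewrite (cong_out _ (proj2 pu)) // oE; apply/andP.
have h0D d : d \in D -> h d0 d = 0 by apply: H2; rewrite ?inE ?eqxx.
have Dd0 d : d \in D -> d != d0 by apply: contraTneq => ->.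
have Dj d : d \in D -> d != j by apply: contraTneq => ->.
have td0 d : d \in t -> d != d0 by apply: contraTneq => ->.
have tj d : d \in t -> d != j by apply: contraTneq => ->.
have g0D d s : d \in D -> (s == d0) || (s == j) -> cong U h d s = 0.
  move=> dD sP; rewrite mix ?Dd0 ?Dj // (herm_eq0 hh (h0D _ dD)) mul0r add0r.
  by rewrite H3 ?mul0r ?Dj // !inE ?eqxx ?dD ?orbT.
have BZ : block_zero [predU1 j & [predU1 d0 & D]] (cong U h).
  move=> k s; rewrite !inE.
  have sym : forall k s, k \in D -> (s == j) || ((s == d0) || (s \in D)) -> k != s ->
       cong U h k s = 0.
    move=> k' s' kD sP ks; case: (boolP ((s' == d0) || (s' == j))) => [|/norP[s1 s2]].
      exact: g0D.
    rewrite (out k' s' (Dd0 _ kD) (Dj _ kD) s1 s2); apply: H3; rewrite // !inE ?kD ?orbT //.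
    by move: sP; rewrite (negbTE s1) (negbTE s2) => ->.
  move=> kP sP ks; case: (boolP (k \in D)) => kD; first exact: sym.
  case: (boolP (s \in D)) => sD.
    by apply: (herm_eq0 hh'); apply: sym; rewrite // eq_sym.
  move: kP sP ks; rewrite (negbTE kD) (negbTE sD) !orbF.
  move=> /orP[] /eqP-> /orP[] /eqP->; rewrite ?eqxx // => _.
  exact: (herm_eq0 hh').
have : block_zero [predU1 j & [predU (mem t) & [predU1 d0 & D]]] g.
  apply: (IH _ _ hh' ut jt _ _ _ _ BZ r).
  - by rewrite !inE negb_or jd0.
  - move=> k kt; rewrite !inE negb_or td0 //=; apply: tD; by rewrite inE kt orbT.
  - move=> k s kt st ks; rewrite out ?td0 ?tj //; apply: H1 => //; rewrite inE ?kt ?st orbT //.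
  - move=> k kt; rewrite mix ?td0 ?tj ?eqxx ?orbT //.
    have kd0 : h k d0 = 0 by apply: H1; rewrite ?inE ?kt ?eqxx ?orbT ?td0.
    (* Since [h k d0 = 0], the new entry at [(k, j)] is [h k j * U j j]. As [U j j != 0], its
       vanishing forces [h k j = 0], and then the old implication covers [D] while the mixing
       formula covers [d0]. *)
    rewrite kd0 mul0r add0r => /eqP; rewrite mulf_eq0 (negbTE Uj) orbF => /eqP kj.
    move=> d; rewrite !inE => /orP[/eqP->|dD].
      by rewrite mix ?td0 ?tj ?eqxx // kd0 kj !mul0r addr0.
    rewrite (out k d (td0 _ kt) (tj _ kt) (Dd0 _ dD) (Dj _ dD)).
    by apply: H2 => //; rewrite inE kt orbT.
move=> H k s; rewrite !inE => kP sP; apply: H; rewrite !inE.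
  by case/or3P: kP => [->|/orP[->|->]|->]; rewrite ?orbT.
by case/or3P: sP => [->|/orP[->|->]|->]; rewrite ?orbT.
Qed.

Definition star_word b (tau : 'I_n -> seq 'I_n) (J : seq 'I_n) : seq pair :=
  flatten [seq map (star b j) (tau j) | j <- J].

(** When column or row [j] is reached, [tau j] lists exactly the indices already treated, whose
    block is zero; its star adds [j] to that block. Within each star the set [D] starts empty. *)
Lemma run_star_word b tau (J0 J : seq 'I_n) h g :
  herm_mx h -> uniq (J0 ++ J) ->
  (forall J1 j J2, J = J1 ++ j :: J2 -> perm_eq (tau j) (J0 ++ J1)) ->
  block_zero (mem J0) h ->
  run (star_word b tau J) h g -> block_zero (mem (J0 ++ J)) g.
Proof.
elim: J J0 h => [|j J IH] J0 h hh uJ tauP bz /=.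
  by move=> <-; rewrite cats0.
rewrite /star_word /= => /run_cat[f r1 r2].
have tj : perm_eq (tau j) J0 by rewrite -[J0]cats0; apply: (tauP [::] j J).
have jJ0 : j \notin J0.
  by move: uJ; rewrite cat_uniq => /and3P[_ /hasPn H _]; apply: H; rewrite inE eqxx.
have := run_star (D := pred0) hh _ _ _ _ _ _ _ r1.
rewrite (perm_uniq tj) (perm_mem tj) => H.
rewrite -cat_rcons; apply: (IH _ f) => //.
- exact: run_herm r1 hh.
- by rewrite cat_rcons.
- by move=> J1 j1 J2 e; rewrite cat_rcons; apply: (tauP (j :: J1) j1 J2); rewrite e.
- move=> k s kP sP.
  have {}kP : k \in j :: J0 by rewrite -mem_rcons.
  have {}sP : s \in j :: J0 by rewrite -mem_rcons.
  rewrite !inE in kP sP.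
  apply: H; rewrite ?inE ?(perm_mem tj) ?orbF //.
  + by move: uJ; rewrite cat_uniq => /and3P[].
  + by move=> r' s'; rewrite !(perm_mem tj); apply: bz.
  + by move=> r' s' /predU1P[->|//] /predU1P[->|//]; rewrite eqxx.
Qed.

Lemma forcing_star_word b tau (J : seq 'I_n) :
  perm_eq J (enum 'I_n) ->
  (forall J1 j J2, J = J1 ++ j :: J2 -> perm_eq (tau j) J1) ->
  forcing (star_word b tau J).
Proof.
move=> pJ tauP h g hh r; apply: (run_offzero_rev hh r) => i j ij.
have inJ k : k \in J by rewrite (perm_mem pJ) mem_enum.
apply: (run_star_word (J0 := [::]) hh _ _ _ r) => //=; rewrite ?(perm_uniq pJ) //.
exact: enum_uniq.
Qed.
End Exact.

(** * Equivalences of orderings and windows of a cyclic strategy *)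

Section SerialOrderings.
Variables (R : realType) (n : nat).
Local Notation pair := ('I_n * 'I_n)%type.
Local Notation forcing := (@forcing R n).

Lemma enum_ord_split (J1 J2 : seq 'I_n) j : enum 'I_n = J1 ++ j :: J2 ->
  J1 = [seq i : 'I_n <- enum 'I_n | (i < j)%N] /\
  J2 = [seq i : 'I_n <- enum 'I_n | (j < i)%N].
Proof.
move=> e; have : pairwise (fun i k : 'I_n => (i < k)%N) (enum 'I_n).
  rewrite -(pairwise_map (fun i : 'I_n => val i) ltn) val_enum_ord.
  rewrite -sorted_pairwise ?iota_ltn_sorted //; exact: ltn_trans.
rewrite e pairwise_cat allrel_consr /= -andbA => /and5P[a1 _ _ a2 _].
rewrite !filter_cat /= !ltnn; split.
  have -> : [seq i : 'I_n <- J2 | (i < j)%N] = [::].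
    apply/eqP; rewrite -(negbK (_ == _)) -has_filter; apply/hasPn => i /(allP a2).
    by rewrite -leqNgt => /ltnW.
  by rewrite cats0; apply/esym/all_filterP.
have -> : [seq i : 'I_n <- J1 | (j < i)%N] = [::].
  apply/eqP; rewrite -(negbK (_ == _)) -has_filter; apply/hasPn => i /(allP a1).
  by rewrite -leqNgt => /ltnW.
by apply/esym/all_filterP.
Qed.

Lemma forcing_C_c (O : seq pair) : C_c O -> forcing O.
Proof.
case=> _ [tau [tauP ->]]; apply: (@forcing_star_word R n true tau (enum 'I_n)) => //.
by move=> J1 j J2 /enum_ord_split[-> _].
Qed.

Lemma forcing_C_r (O : seq pair) : C_r O -> forcing O.
Proof.
case=> _ [tau [tauP ->]].
apply: (@forcing_star_word R n false tau (rev (enum 'I_n))); first by rewrite perm_rev.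
(* What precedes [j] in the reversed enumeration is what follows it in [enum 'I_n], namely the
   indices above [j]. *)
move=> J1 j J2 /(congr1 rev); rewrite revK rev_cat rev_cons cat_rcons.
by case/enum_ord_split => _ e; rewrite (perm_trans (tauP j)) // -e perm_rev.
Qed.

Lemma forcing_C_sp (O : seq pair) : C_sp O -> forcing O.
Proof.
case=> [/forcing_C_c//|[/forcing_C_r//|[]]] H; apply: forcing_rev.
  exact: forcing_C_c.
exact: forcing_C_r.
Qed.

Definition cycles m (O : seq pair) := flatten (nseq m O).

(** One cycle of a shifted ordering need not contain a forcing word, but several cycles do; the
    existential count absorbs the cost of each shift in a chain. *)
Definition cyc_forcing (O : seq pair) := exists m, forcing (cycles m O).

(** Cutting [m + 1] cycles at the shift point exposes [m] full cycles of the shifted ordering, so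
    [forcing_infix] applies. *)
Lemma cycles_shift m (O1 O2 : seq pair) :
  cycles m.+1 (O1 ++ O2) = O1 ++ cycles m (O2 ++ O1) ++ O2.
Proof.
elim: m => [|m IH]; first by rewrite /cycles /= cats0.
have cS k (s : seq pair) : cycles k.+1 s = s ++ cycles k s by [].
by rewrite cS IH cS !catA.
Qed.

Lemma equiv_ord_catl (s t u : seq pair) : equiv_ord t u -> equiv_ord (s ++ t) (s ++ u).
Proof.
elim=> {t u} [t u [s1 [s2 [p [q [-> [-> d]]]]]]|t|t u v _ IH1 _ IH2].
- apply: rt_step; exists (s ++ s1), s2, p, q; rewrite !catA; do !split=> //.
- exact: rt_refl.
- exact: rt_trans IH2.
Qed.

Lemma equiv_ord_catr (s t u : seq pair) : equiv_ord t u -> equiv_ord (t ++ s) (u ++ s).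
Proof.
elim=> {t u} [t u [s1 [s2 [p [q [-> [-> d]]]]]]|t|t u v _ IH1 _ IH2].
- apply: rt_step; exists s1, (s2 ++ s), p, q; rewrite -!catA; do !split=> //.
- exact: rt_refl.
- exact: rt_trans IH2.
Qed.

Lemma equiv_ord_cycles m (t u : seq pair) :
  equiv_ord t u -> equiv_ord (cycles m t) (cycles m u).
Proof.
move=> e; elim: m => [|m IH]; first exact: rt_refl.
rewrite /cycles /=; apply: (rt_trans _ _ _ (u ++ cycles m t)).
  exact: equiv_ord_catr.
exact: equiv_ord_catl.
Qed.

Lemma forcing_equiv (t u : seq pair) : equiv_ord t u -> forcing u -> forcing t.
Proof.
elim=> {t u} [t u a|//|t u v _ IH1 _ IH2 /IH2/IH1//].
exact: forcing_adm.
Qed.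

Lemma cyc_forcing_weak (t u : seq pair) :
  weak_equiv t u -> cyc_forcing u -> cyc_forcing t.
Proof.
elim=> {t u} [t u [e|[O1 [O2 [-> ->]]]] [m f]|//|t u v _ IH1 _ IH2 /IH2/IH1//].
  by exists m; apply: forcing_equiv f; apply: equiv_ord_cycles.
by exists m.+1; rewrite cycles_shift; apply: forcing_infix.
Qed.

Lemma cyc_forcing_perm (t u : seq pair) :
  perm_equiv t u -> cyc_forcing u -> cyc_forcing t.
Proof.
case=> q -> [m f]; exists m; apply: (@forcing_perm _ _ q).
by move: f; rewrite /cycles map_flatten map_nseq.
Qed.

Lemma cyc_forcing_C_sg (O : seq pair) : C_sg O -> cyc_forcing O.
Proof.
case=> _ [O' [O'' [sp H]]].
have f : cyc_forcing O'' by exists 1%N; rewrite /cycles /= cats0; apply: forcing_C_sp.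
case: H => -[].
  by move=> p w; apply: (cyc_forcing_perm p); apply: cyc_forcing_weak f.
by move=> w p; apply: (cyc_forcing_weak w); apply: cyc_forcing_perm f.
Qed.

Lemma size_ordering (O : seq pair) : is_ordering O -> size O = Npairs n.
Proof.
move/perm_size->; rewrite /all_pairs size_flatten /shape -map_comp sumnE big_map.
have -> : \sum_(i <- enum 'I_n) (size \o (fun i : 'I_n =>
    [seq (i, j) | j <- [seq j : 'I_n <- enum 'I_n | (i < j)%N]])) i = (\sum_(i < n) (n - i.+1))%N.
  rewrite big_enum /=; apply: eq_bigr => i _; rewrite size_map size_filter.
  rewrite -(count_map (fun j : 'I_n => val j) (fun j => (i < j)%N)) val_enum_ord.
  have -> : iota 0 n = iota 0 i.+1 ++ iota i.+1 (n - i.+1).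
    by rewrite -{2}[i.+1]add0n -iotaD subnKC.
  rewrite count_cat (eq_in_count (a2 := pred0)) ?count_pred0; last first.
    by move=> k; rewrite mem_iota /= add0n ltnS ltnNge => ->.
  rewrite (eq_in_count (a2 := predT)) ?count_predT ?size_iota //.
  by move=> k; rewrite mem_iota => /andP[].
rewrite -(big_mkord predT (fun i => n - i.+1)%N) big_nat_rev /=.
rewrite (eq_big_nat _ _ (F2 := id)); last by move=> i /andP[_ ?]; rewrite add0n; lia.
by rewrite bin2_sum bin2 /Npairs subn1 divn2.
Qed.

Lemma ordering_lt (O : seq pair) p : is_ordering O -> p \in O -> (p.1 < p.2)%N.
Proof.
move/perm_mem->; case/flattenP=> t /mapP[i _ ->] /mapP[j].
by rewrite mem_filter => /andP[ij _] ->.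
Qed.

Lemma Npairs_gt0 : (2 <= n)%N -> (0 < Npairs n)%N.
Proof.
move=> n2; rewrite divn_gt0 // (@leq_trans (2 * 1)%N) // leq_mul //; lia.
Qed.

Definition window (piv : nat -> pair) k T : seq pair := map piv (iota k T).

Lemma window_cat piv k T1 T2 :
  window piv k (T1 + T2) = window piv k T1 ++ window piv (k + T1) T2.
Proof. by rewrite /window iotaD map_cat. Qed.

Lemma window_cycles (O : seq pair) dflt l m : size O = Npairs n ->
  window (cyc_strategy O dflt) (l * Npairs n) (m * Npairs n) = cycles m O.
Proof.
move=> sO; elim: m l => [|m IH] l; first by rewrite mul0n.
rewrite mulSn window_cat -mulSnr IH /cycles /=; congr (_ ++ _).
rewrite /window -[X in iota X]addn0 iotaDl -map_comp -sO -[RHS](mkseq_nth dflt).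
apply/eq_in_map => t; rewrite mem_iota add0n => /andP[_ tO] /=.
by rewrite /cyc_strategy -sO modnMDl modn_small.
Qed.

Lemma forcing_window (O : seq pair) dflt : (2 <= n)%N -> C_sg O ->
  exists T, forall k, forcing (window (cyc_strategy O dflt) k T).
Proof.
move=> n2 CO; have sO := size_ordering (proj1 CO).
have [m f] := cyc_forcing_C_sg CO; set N := Npairs n in sO *.
have N0 : (0 < N)%N := Npairs_gt0 n2.
exists (m.+1 * N)%N => k.
(* [r] is the distance from [k] to the next multiple of [N] strictly above it, so [r = N] when [N]
   divides [k]. The extra cycle in the window length pays for this prefix and the tail [N - r],
   leaving [m] aligned cycles between them. *)
pose r := (N - k %% N)%N.
have rN : (r <= N)%N by rewrite leq_subr.
have kr : (k + r = (k %/ N).+1 * N)%N.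
  by rewrite {1}(divn_eq k N) /r; have := ltn_pmod k N0; lia.
have -> : (m.+1 * N = r + (m * N + (N - r)))%N by lia.
rewrite window_cat window_cat kr window_cycles //.
exact: forcing_infix.
Qed.

End SerialOrderings.

(** * Limits of complex sequences along filters *)

Section ComplexNorm.
Variable R : realType.
Local Notation C := R[i].

(** The norm on [R[i]] takes its values in [R[i]]; the real-valued version lets estimates be closed
    by real arithmetic. *)
Definition nm (x : C) : R := Normc.normc x.
Definition toC (x : R) : C := real_complex R x.

Lemma nmE (x : C) : `|x| = toC (nm x). Proof. by []. Qed.

Lemma toC_inj : injective toC. Proof. exact: complexI. Qed.

Lemma toC_le x y : (toC x <= toC y) = (x <= y). Proof. exact: lecR. Qed.

Lemma toC_lt x y : (toC x < toC y) = (x < y). Proof. exact: ltcR. Qed.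

Lemma toC0 : toC 0 = 0. Proof. exact: rmorph0. Qed.
Lemma toC1 : toC 1 = 1. Proof. exact: rmorph1. Qed.
Lemma toCD x y : toC (x + y) = toC x + toC y. Proof. exact: rmorphD. Qed.
Lemma toCN x : toC (- x) = - toC x. Proof. exact: rmorphN. Qed.
Lemma toCM x y : toC (x * y) = toC x * toC y. Proof. exact: rmorphM. Qed.
Lemma toCX x k : toC (x ^+ k) = toC x ^+ k. Proof. exact: rmorphXn. Qed.
Lemma toC_sum I r (P : pred I) F :
  toC (\sum_(i <- r | P i) F i) = \sum_(i <- r | P i) toC (F i).
Proof. exact: rmorph_sum. Qed.

Lemma nm_ge0 x : 0 <= nm x. Proof. by rewrite -toC_le toC0 -nmE. Qed.

Lemma nm0 : nm 0 = 0. Proof. by apply: toC_inj; rewrite -nmE normr0 toC0. Qed.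

Lemma nm1 : nm 1 = 1. Proof. by apply: toC_inj; rewrite -nmE normr1 toC1. Qed.

Lemma nm_eq0 x : nm x = 0 -> x = 0. Proof. exact: Normc.eq0_normc. Qed.

Lemma nmM x y : nm (x * y) = nm x * nm y. Proof. exact: Normc.normcM. Qed.

Lemma nmN x : nm (- x) = nm x. Proof. by apply: toC_inj; rewrite -!nmE normrN. Qed.

Lemma nmB x y : nm (x - y) = nm (y - x). Proof. by rewrite -nmN opprB. Qed.

Lemma nmD x y : nm (x + y) <= nm x + nm y.
Proof. by rewrite -toC_le toCD -!nmE ler_normD. Qed.

Lemma nm_conj x : nm x^* = nm x.
Proof. by apply: toC_inj; rewrite -!nmE norm_conjC. Qed.

Lemma nm_toC x : nm (toC x) = `|x|.
Proof. by apply: toC_inj; rewrite /nm /toC /= expr0n /= addr0 sqrtr_sqr. Qed.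

Lemma nm_sqr x : toC (nm x ^+ 2) = x * x^*.
Proof. by rewrite toCX -nmE normCK. Qed.

Lemma nm_ge_Re (x : C) : `|complex.Re x| <= nm x.
Proof. by rewrite -toC_le -nmE; apply: normc_ge_Re. Qed.

Lemma conj_toC x : (toC x)^* = toC x.
Proof. by apply/CrealP/complex_realP; exists x. Qed.

Lemma nm_triangle x y z : nm (x - z) <= nm (x - y) + nm (y - z).
Proof. by apply: le_trans (nmD _ _); rewrite addrA subrK. Qed.

End ComplexNorm.
Arguments nm : simpl never.
Arguments toC : simpl never.

Section Limits.
Variable R : realType.
Local Notation C := R[i].
Local Open Scope classical_set_scope.

(** The filter is a parameter so that the same limit rules serve the tail filter and
    ultrafilters. *)
Definition flim (F : set_system nat) (u : nat -> C) (l : C) : Prop :=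
  forall e : R, 0 < e -> F [set k | nm (u k - l) < e].

Definition bounded_seq (u : nat -> C) : Prop := exists M : R, forall k, nm (u k) <= M.

Section OneFilter.
Context {F : set_system nat} {FF : ProperFilter F}.

Lemma flim_cst l : flim F (fun=> l) l.
Proof. by move=> e e0; apply: filterS filterT => k _ /=; rewrite subrr nm0. Qed.

Lemma flim_near_eq u v l : F [set k | u k = v k] -> flim F u l -> flim F v l.
Proof. by move=> uv ul e e0; apply: filterS2 uv (ul e e0) => k /= ->. Qed.

Lemma flim_unique u l l' : flim F u l -> flim F u l' -> l = l'.
Proof.
move=> ul ul'; apply/eqP; rewrite -subr_eq0; apply/eqP/nm_eq0/eqP.
rewrite eq_le nm_ge0 andbT; apply/ler_addgt0Pr => e e0; rewrite add0r.
have e20 : 0 < e / 2 by lra.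
have [k [/= a b]] := filter_ex (filterI (ul _ e20) (ul' _ e20)).
by have := nm_triangle l (u k) l'; rewrite (nmB l (u k)); lra.
Qed.

Lemma flimD u v l m : flim F u l -> flim F v m ->
  flim F (fun k => u k + v k) (l + m).
Proof.
move=> ul vm e e0; have e20 : 0 < e / 2 by lra.
apply: filterS2 (ul _ e20) (vm _ e20) => k /= a b.
have -> : u k + v k - (l + m) = (u k - l) + (v k - m) by ring.
by have := nmD (u k - l) (v k - m); lra.
Qed.

Lemma flim_conj u l : flim F u l -> flim F (fun k => (u k)^*) l^*.
Proof.
by move=> ul e e0; apply: filterS (ul e e0) => k /=; rewrite -rmorphB nm_conj.
Qed.

Lemma flim_squeeze u v (M : R) : (forall k, nm (u k) <= M * nm (v k)) ->
  flim F v 0 -> flim F u 0.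
Proof.
move=> uv v0 e e0; have M0 : 0 < `|M| + 1 by have := normr_ge0 M; lra.
have d0 : 0 < e / (`|M| + 1) by apply: divr_gt0.
apply: filterS (v0 _ d0) => k /=; rewrite !subr0 ltr_pdivlMr // => h.
apply: le_lt_trans h; apply: le_trans (uv k) _; rewrite mulrC.
apply: ler_wpM2l; first exact: nm_ge0.
by have := ler_norm M; lra.
Qed.

Lemma flimM u v l m : flim F u l -> flim F v m ->
  flim F (fun k => u k * v k) (l * m).
Proof.
move=> ul vm e e0.
have M0 : 0 < nm l + nm m + 1 by have := nm_ge0 l; have := nm_ge0 m; lra.
have d0 : 0 < Num.min 1 (e / 2 / (nm l + nm m + 1)).
  by rewrite lt_min ltr01 /= divr_gt0 // divr_gt0.
apply: filterS2 (ul _ d0) (vm _ d0) => k /=; rewrite !lt_min => /andP[a1 a2] /andP[b1 b2].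
have -> : u k * v k - l * m = (u k - l) * (v k - m) + (u k - l) * m + l * (v k - m) by ring.
have t1 := nmD ((u k - l) * (v k - m) + (u k - l) * m) (l * (v k - m)).
have t2 := nmD ((u k - l) * (v k - m)) ((u k - l) * m).
rewrite !nmM in t1 t2.
move: a2 b2; rewrite !ltr_pdivlMr // => a2 b2.
have ge1 := nm_ge0 (u k - l); have ge2 := nm_ge0 (v k - m).
have gl := nm_ge0 l; have gm := nm_ge0 m.
move: t1 t2 a1 a2 b1 b2 ge1 ge2 gl gm.
move: (nm (u k - l)) (nm (v k - m)) (nm l) (nm m) => x y p q t1 t2 a1 a2 b1 b2 x0 y0 p0 q0.
have xy : x * y <= x by nra.
nra.
Qed.

Lemma flimN u l : flim F u l -> flim F (fun k => - u k) (- l).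
Proof. by move=> ul e /ul; apply: filterS => k /=; rewrite -opprD nmN. Qed.

Lemma flimB u v l m : flim F u l -> flim F v m ->
  flim F (fun k => u k - v k) (l - m).
Proof. by move=> ul vm; apply: flimD => //; apply: flimN. Qed.

Lemma flim_sum (I : Type) (r : seq I) (P : pred I) (u : I -> nat -> C) (l : I -> C) :
  (forall i, P i -> flim F (u i) (l i)) ->
  flim F (fun k => \sum_(i <- r | P i) u i k) (\sum_(i <- r | P i) l i).
Proof.
move=> ul; elim: r => [|i r IH].
  by rewrite big_nil; under eq_fun do rewrite big_nil; apply: flim_cst.
rewrite big_cons; under eq_fun do rewrite big_cons.
by case: ifP => // Pi; apply: flimD => //; apply: ul.
Qed.

Lemma flim_prod (I : Type) (r : seq I) (P : pred I) (u : I -> nat -> C) (l : I -> C) :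
  (forall i, P i -> flim F (u i) (l i)) ->
  flim F (fun k => \prod_(i <- r | P i) u i k) (\prod_(i <- r | P i) l i).
Proof.
move=> ul; elim: r => [|i r IH].
  by rewrite big_nil; under eq_fun do rewrite big_nil; apply: flim_cst.
rewrite big_cons; under eq_fun do rewrite big_cons.
by case: ifP => // Pi; apply: flimM => //; apply: ul.
Qed.

Lemma flim_neq0 u l (c : R) : 0 < c -> F [set k | c <= nm (u k)] -> flim F u l -> l != 0.
Proof.
move=> c0 uc ul; apply/eqP => l0.
have [k [/= a b]] := filter_ex (filterI uc (ul _ c0)).
by move: b; rewrite l0 subr0; lra.
Qed.

Lemma flim_toC_le (x : nat -> R) (l c : R) : F [set k | x k <= c] ->
  flim F (fun k => toC (x k)) (toC l) -> l <= c.
Proof.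
move=> xc xl; apply/ler_addgt0Pr => e e0.
have [k [/= a b]] := filter_ex (filterI xc (xl _ e0)).
by move: b; rewrite -toCN -toCD nm_toC ltr_norml => /andP[]; lra.
Qed.

Lemma flim_subseq (phi : nat -> nat) u l : (forall N, F [set k | (N <= phi k)%N]) ->
  flim \oo u l -> flim F (fun k => u (phi k)) l.
Proof.
move=> phiF ul e e0; have [N _ H] := ul e e0.
by apply: filterS (phiF N) => k /= /H.
Qed.

Definition mlim m p (M : nat -> 'M[C]_(m, p)) (L : 'M[C]_(m, p)) : Prop :=
  forall r s, flim F (fun k => M k r s) (L r s).

Lemma mlim_unique m p (M : nat -> 'M[C]_(m, p)) L L' : mlim M L -> mlim M L' -> L = L'.
Proof. by move=> a b; apply/matrixP => r s; apply: flim_unique (a r s) (b r s). Qed.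

Lemma mlim_cst m p (L : 'M[C]_(m, p)) : mlim (fun=> L) L.
Proof. by move=> r s; apply: flim_cst. Qed.

Lemma mlim_mul m p q (M : nat -> 'M[C]_(m, p)) (N : nat -> 'M[C]_(p, q)) L K :
  mlim M L -> mlim N K -> mlim (fun k => M k *m N k) (L *m K).
Proof.
move=> ML NK r s; rewrite mxE; under eq_fun do rewrite mxE.
by apply: flim_sum => i _; apply: flimM.
Qed.

Lemma mlim_ctr m p (M : nat -> 'M[C]_(m, p)) L :
  mlim M L -> mlim (fun k => ctrmx (M k)) (ctrmx L).
Proof. by move=> ML r s; rewrite mxE; under eq_fun do rewrite mxE; apply: flim_conj. Qed.

Lemma mlim_cong n (U H : nat -> 'M[C]_n) V K :
  mlim U V -> mlim H K -> mlim (fun k => cong (U k) (H k)) (cong V K).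
Proof. by move=> UV HK; apply: mlim_mul => //; apply: mlim_mul => //; apply: mlim_ctr. Qed.

Lemma mlim_det n (M : nat -> 'M[C]_n) L :
  mlim M L -> flim F (fun k => \det (M k)) (\det L).
Proof.
move=> ML; apply: flim_sum => s _; apply: flimM; first exact: flim_cst.
by apply: flim_prod => i _; apply: ML.
Qed.

End OneFilter.

Definition bounded_mx m p (M : nat -> 'M[C]_(m, p)) : Prop :=
  exists B : R, forall k r s, nm (M k r s) <= B.

(** The limit is the supremum of the reals lying below the sequence on a set of the ultrafilter: a
    slightly larger real is not such a bound, so by maximality the sequence is below it on a set of
    [G]. *)
Lemma ultra_lim_real (G : set_system nat) (x : nat -> R) (M : R) : UltraFilter G ->
  (forall k, `|x k| <= M) -> exists l, flim G (fun k => toC (x k)) (toC l).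
Proof.
move=> UG xM; pose E : set R := [set c | G [set k | c <= x k]].
have supE : has_sup E; last exists (sup E).
  split; first by exists (- M); apply: filterS filterT => k _ /=;
    have := xM k; rewrite ler_norml => /andP[].
  exists M => c /= Gc; have [k /= ck] := filter_ex Gc.
  by apply: le_trans ck _; apply: le_trans (ler_norm _) (xM k).
move=> e e0; have [c Ec sc] := sup_adherent e0 supE.
have : ~ E (sup E + e / 2).
  move=> /(ub_le_sup (proj2 supE)); lra.
have [//|Gn _] := in_ultra_setVsetC [set k | sup E + e / 2 <= x k] UG.
apply: filterS2 Ec Gn => k /= a /negP; rewrite -ltNge => b.
by rewrite -toCN -toCD nm_toC ltr_norml; apply/andP; split; lra.
Qed.

Lemma ultra_lim (G : set_system nat) (u : nat -> C) : UltraFilter G ->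
  bounded_seq u -> exists l, flim G u l.
Proof.
move=> UG [M uM].
have [a la] : exists a, flim G (fun k => toC (complex.Re (u k))) (toC a).
  apply: (@ultra_lim_real _ _ M UG) => k; exact: le_trans (nm_ge_Re _) (uM k).
have [b lb] : exists b, flim G (fun k => toC (complex.Im (u k))) (toC b).
  apply: (@ultra_lim_real _ _ M UG) => k; apply: le_trans (uM k).
  have -> : complex.Im (u k) = - complex.Re (u k * 'i%C) by rewrite ReiNIm opprK.
  rewrite normrN; apply: le_trans (nm_ge_Re _) _.
  by rewrite nmM /nm [X in _ * X]/= expr0n expr1n add0r sqrtr1 mulr1.
exists (toC a + 'i%C * toC b).
have -> : u = fun k => toC (complex.Re (u k)) + 'i%C * toC (complex.Im (u k)).
  by apply/funext => k; apply: complexE.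
by apply: flimD => //; apply: flimM => //; apply: flim_cst.
Qed.

Lemma ultra_mlim (G : set_system nat) m p (M : nat -> 'M[C]_(m, p)) : UltraFilter G ->
  bounded_mx M -> exists L, mlim (F := G) M L.
Proof.
move=> UG [B MB].
have H (rs : 'I_m * 'I_p) : exists l, flim G (fun k => M k rs.1 rs.2) l.
  by apply: ultra_lim; exists B.
have [L HL] := choice H.
by exists (\matrix_(r, s) L (r, s)) => r s; rewrite mxE; apply: (HL (r, s)).
Qed.

(** Otherwise every value would be avoided on a set of [G], and the intersection of these finitely
    many sets would be empty. It fixes one word of pivots for all the windows. *)
Lemma ultra_const (G : set_system nat) (I : finType) (f : nat -> I) : UltraFilter G ->
  exists k0, G [set k | f k = f k0].
Proof.
move=> UG; apply: contrapT => H.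
have : G [set k | forall i : I, f k <> i].
  apply: filter_forall => i.
  have [Gi|//] := in_ultra_setVsetC [set k | f k = i] UG.
  by case: H; have [k0 /= e] := filter_ex Gi; exists k0; rewrite e.
by move=> /filter_ex[k /= /(_ (f k))].
Qed.

Lemma limsup_exists (x : nat -> R) (M : R) : (forall k, 0 <= x k <= M) ->
  exists L : R, (forall e, 0 < e -> \oo [set k | x k <= L + e]) /\
    (forall e N, 0 < e -> exists2 k, (N <= k)%N & L - e < x k).
Proof.
move=> xM; pose E : set R := [set c | \oo [set k | x k <= c]].
have lbE : has_lbound E.
  exists 0 => c /filter_ex[k /= xc]; have := xM k; lra.
have infE : has_inf E.
  by split=> //; exists M; apply: filterS filterT => k _ /=; have := xM k; lra.
exists (inf E); split=> [e e0|e N e0].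
  have [c Ec cl] := inf_adherent e0 infE.
  by apply: filterS Ec => k /=; lra.
apply: contrapT => H.
have : E (inf E - e).
  exists N => // k /= Nk; rewrite leNgt; apply/negP => lt; apply: H; exists k => //.
by move/(ge_inf lbE); lra.
Qed.

End Limits.

(** * Convergence of the off-diagonal part *)

Section OffNorm.
Variables (R : realType) (n : nat).
Local Notation C := R[i].
Local Notation pair := ('I_n * 'I_n)%type.
Implicit Types (h U : 'M[C]_n) (p : pair).

Definition off2 (h : 'M[C]_n) : R := \sum_r \sum_(s | s != r) nm (h r s) ^+ 2.

Lemma off2_ge0 h : 0 <= off2 h.
Proof. by apply: sumr_ge0 => r _; apply: sumr_ge0 => s _; apply: sqr_ge0. Qed.

Lemma off2_ge h r s : r != s -> nm (h r s) ^+ 2 <= off2 h.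
Proof.
move=> rs; rewrite /off2 (bigD1 r) //= (bigD1 s) 1?eq_sym //= -addrA lerDl.
by apply: addr_ge0; repeat (apply: sumr_ge0 => ? _); apply: sqr_ge0.
Qed.

Lemma offzero_off2 h : offzero h -> off2 h = 0.
Proof.
by move=> h0; rewrite /off2 big1 // => r _; rewrite big1 // => s sr;
  rewrite h0 1?eq_sym // nm0 expr0n.
Qed.

Lemma off2_bounded h (M : R) : (forall r s, nm (h r s) <= M) ->
  off2 h <= \sum_(r < n) \sum_(s < n) M ^+ 2.
Proof.
move=> hM; apply: ler_sum => r _; rewrite big_mkcond; apply: ler_sum => s _.
case: ifP => _; last exact: sqr_ge0.
by rewrite lerXn2r ?nnegrE ?nm_ge0 //; apply: le_trans (hM r s); apply: nm_ge0.
Qed.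

Lemma off2_lim (F : set_system nat) (FF : ProperFilter F) (H : nat -> 'M[C]_n) h :
  mlim (F := F) H h -> flim F (fun k => toC (off2 (H k))) (toC (off2 h)).
Proof.
move=> Hh; rewrite /off2 toC_sum; under eq_fun do rewrite toC_sum.
apply: flim_sum => r _; rewrite toC_sum; under eq_fun do rewrite toC_sum.
apply: flim_sum => s _; rewrite nm_sqr; under eq_fun do rewrite nm_sqr.
by apply: flimM; [|apply: flim_conj]; apply: Hh.
Qed.

(** Apart from the pivot term, the right-hand side involves only full norms of rows outside the
    pivot plane and entries with both indices outside it. A unitary in the plane preserves all of
    these, so the off-norm changes by the pivot alone. *)
Lemma off2_split (p : pair) h : p.1 != p.2 -> herm_mx h ->
  off2 h = \sum_(r | outside p r) (2 * \sum_s nm (h r s) ^+ 2 - nm (h r r) ^+ 2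
      - \sum_(s | outside p s) nm (h r s) ^+ 2) + 2 * nm (h p.1 p.2) ^+ 2.
Proof.
case: p => i j /= ij hh.
have sym r s : nm (h r s) ^+ 2 = nm (h s r) ^+ 2 by rewrite (hermE s r hh) nm_conj.
have split2 (f : 'I_n -> R) : \sum_s f s = f i + f j + \sum_(s | outside (i, j) s) f s.
  rewrite (bigD1 i) //= (bigD1 j) 1?eq_sym //= addrA.
  by congr (_ + _); apply: eq_bigl => s; rewrite /outside /=.
have nr r : \sum_(s | s != r) nm (h r s) ^+ 2 = \sum_s nm (h r s) ^+ 2 - nm (h r r) ^+ 2.
  by rewrite [in RHS](bigD1 r) //=; ring.
rewrite /off2 split2 !nr !split2.
have e : \sum_(s | outside (i, j) s) nm (h i s) ^+ 2 +
         \sum_(s | outside (i, j) s) nm (h j s) ^+ 2 =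
  \sum_(r | outside (i, j) r) (\sum_s nm (h r s) ^+ 2 -
       \sum_(s | outside (i, j) s) nm (h r s) ^+ 2).
  rewrite -big_split /=; apply: eq_bigr => r _.
  by rewrite split2 (sym i) (sym j); ring.
have -> : \sum_(r | outside (i, j) r) (2 * \sum_s nm (h r s) ^+ 2 - nm (h r r) ^+ 2
      - \sum_(s | outside (i, j) s) nm (h r s) ^+ 2) =
   \sum_(r | outside (i, j) r) (\sum_s nm (h r s) ^+ 2 - nm (h r r) ^+ 2) +
  \sum_(r | outside (i, j) r) (\sum_s nm (h r s) ^+ 2 -
       \sum_(s | outside (i, j) s) nm (h r s) ^+ 2).
  rewrite -big_split /=; apply: eq_bigr => r _; ring.
have -> : \sum_(r | outside (i, j) r) (\sum_s nm (h r s) ^+ 2 - nm (h r r) ^+ 2) =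
    \sum_(r | outside (i, j) r) \sum_(s | s != r) nm (h r s) ^+ 2.
  by apply: eq_bigr => r _; rewrite nr.
rewrite -e.
by rewrite (sym j i); ring.
Qed.

Lemma row_norm_cong p U h r : plane_unitary p U -> outside p r ->
  \sum_s nm (cong U h r s) ^+ 2 = \sum_s nm (h r s) ^+ 2.
Proof.
move=> pU or; apply: toC_inj.
have E (g : 'M[C]_n) : toC (\sum_s nm (g r s) ^+ 2) = (g *m ctrmx g) r r.
  by rewrite toC_sum mxE; apply: eq_bigr => s _; rewrite nm_sqr ctrmxE.
transitivity (toC (\sum_s nm ((h *m U) r s) ^+ 2)).
  by congr toC; apply: eq_bigr => s _; rewrite (cong_row _ _ (proj2 pU)).
rewrite !E ctrmx_mul mulmxA -[h *m U *m _]mulmxA.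
by case: pU => UU _; rewrite (mulmx1C UU) mulmx1.
Qed.

Lemma off2_cong p U h : p.1 != p.2 -> plane_unitary p U -> herm_mx h ->
  cong U h p.1 p.2 = 0 -> off2 (cong U h) = off2 h - 2 * nm (h p.1 p.2) ^+ 2.
Proof.
move=> np pU hh h'0; rewrite !(off2_split np) //; last exact: herm_cong.
rewrite h'0 nm0 expr0n mulr0 addr0 addrK; apply: eq_bigr => r or.
rewrite (row_norm_cong _ pU) // (cong_out _ (proj2 pU)) //; congr (_ - _).
by apply: eq_bigr => s os; rewrite (cong_out _ (proj2 pU)).
Qed.

Lemma plane_unitary_nm_le1 p U r s : plane_unitary p U -> nm (U r s) <= 1.
Proof.
case=> UU _; have : (ctrmx U *m U) s s = 1 by rewrite UU mxE eqxx.
rewrite mxE (eq_bigr (fun k => toC (nm (U k s) ^+ 2))); last first.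
  by move=> k _; rewrite nm_sqr ctrmxE mulrC.
rewrite -toC_sum -toC1 => /toC_inj; rewrite (bigD1 r) //= => e.
have : 0 <= \sum_(k | k != r) nm (U k s) ^+ 2 by apply: sumr_ge0 => k _; apply: sqr_ge0.
by have := nm_ge0 (U r s); nra.
Qed.

Local Open Scope classical_set_scope.

(* Otherwise let [L > 0] be the limit superior of the squared off-norm.  Limits,
   along an ultrafilter, of windows that end near [L] form an exact process
   whose off-norm never exceeds [L] and ends at [L]: it loses nothing, so it
   is killed by the forcing word. *)
Theorem offdiag_cvg0 (H Z K U : nat -> 'M[C]_n) (piv : nat -> pair) (T : nat) (c : R) :
  bounded_mx H -> (forall k, herm_mx (H k)) ->
  (forall k, H k.+1 = cong (Z k) (H k)) -> (forall k, Z k = K k *m U k) ->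
  mlim (F := \oo) K 1%:M ->
  (forall k, (piv k).1 != (piv k).2) ->
  (forall k, plane_unitary (piv k) (U k)) -> 0 < c ->
  (forall k, c <= nm (U k (piv k).1 (piv k).1)) ->
  (forall k, c <= nm (U k (piv k).2 (piv k).2)) ->
  (forall k, H k.+1 (piv k).1 (piv k).2 = 0) ->
  (forall k, forcing R (window piv k T)) ->
  forall r s, r != s -> flim \oo (fun k => H k r s) 0.
Proof.
move=> [M HM] hH HS ZK K1 np pU c0 U1 U2 H0 fT.
have xM k : 0 <= off2 (H k) <= \sum_(r < n) \sum_(s < n) M ^+ 2.
  by rewrite off2_ge0 off2_bounded.
have [L [Lup Llow]] := limsup_exists xM.
suff L0 : L <= 0.
  move=> r s rs e e0; have e20 : 0 < e ^+ 2 / 2 by have := exprn_gt0 2 e0; lra.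
  apply: filterS (Lup _ e20) => k /= xk; rewrite subr0.
  have := off2_ge (H k) rs; have := nm_ge0 (H k r s).
  by have := exprn_gt0 2 e0; nra.
(* [phi j] is the end of the [j]-th window: late enough to leave [T] steps before it and with
   off-norm above [L - 1/(j+1)]. The starts [psi j] then also tend to infinity. *)
have exphi j : exists k, (j + T <= k)%N /\ L - j.+1%:R^-1 < off2 (H k).
  have i0 : 0 < j.+1%:R^-1 :> R by rewrite invr_gt0 ltr0n.
  by have [k ? ?] := Llow _ (j + T)%N i0; exists k.
have [phi phiP] := choice exphi.
have [G [UG ooG]] := @ultraFilterLemma nat \oo _.
pose psi j := (phi j - T)%N.
have psiK j : (psi j + T)%N = phi j.
  by rewrite subnK //; have [] := phiP j; lia.
have psi_oo t N : G [set j | (N <= psi j + t)%N].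
  apply: ooG; exists N => // j /= Nj; have [] := phiP j; rewrite /psi; lia.
have [j0 Gj0] := ultra_const (fun j => [ffun t : 'I_T => piv (psi j + t)%N]) UG.
pose k0 := psi j0.
have pivG t : (t < T)%N -> G [set j | piv (psi j + t)%N = piv (k0 + t)%N].
  move=> tT; apply: filterS Gj0 => j /= /ffunP /(_ (Ordinal tT)).
  by rewrite !ffunE.
have exh t : exists g, mlim (F := G) (fun j => H (psi j + t)%N) g.
  by apply: ultra_mlim; exists M => j r s; apply: HM.
have [h hP] := choice exh.
have exV t : exists W, mlim (F := G) (fun j => U (psi j + t)%N) W.
  apply: ultra_mlim; exists 1 => j r s.
  exact: plane_unitary_nm_le1 (pU _).
have [V VP] := choice exV.
have hh t : herm_mx (h t).
  apply: (@mlim_unique _ G _ _ _ (fun j => H (psi j + t)%N)); last exact: hP.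
  have -> : (fun j => H (psi j + t)%N) = (fun j => ctrmx (H (psi j + t)%N)).
    by apply/funext => j; rewrite hH.
  exact: mlim_ctr.
have hS t : h t.+1 = cong (V t) (h t).
  apply: (@mlim_unique _ G _ _ _ (fun j => H (psi j + t.+1)%N)); first exact: hP.
  have -> : (fun j => H (psi j + t.+1)%N) =
      (fun j => cong (K (psi j + t)%N *m U (psi j + t)%N) (H (psi j + t)%N)).
    by apply/funext => j; rewrite addnS HS ZK.
  (* Only the unitary part survives in the limit, because [K] tends to the identity along the
     shifted indices too. *)
  rewrite -[V t]mul1mx; apply: mlim_cong => //; apply: mlim_mul => // r s.
  exact: (flim_subseq (psi_oo t) (K1 r s)).
have pV t : (t < T)%N -> plane_unitary (piv (k0 + t)%N) (V t).
  move=> tT; split.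
    apply: (@mlim_unique _ G _ _ _
      (fun j => ctrmx (U (psi j + t)%N) *m U (psi j + t)%N)).
      by apply: mlim_mul => //; apply: mlim_ctr.
    have -> : (fun j => ctrmx (U (psi j + t)%N) *m U (psi j + t)%N) = fun=> 1%:M.
      by apply/funext => j; have [] := pU (psi j + t)%N.
    exact: mlim_cst.
  move=> r s o; apply: (@flim_unique _ G _ _ _ _ (VP t r s)).
  apply: (@flim_near_eq _ G _ (fun=> (r == s)%:R)); last exact: flim_cst.
  apply: filterS (pivG t tT) => j /= e; have [_ ->//] := pU (psi j + t)%N.
  by rewrite e.
have rV t : (t < T)%N -> plane_rot (piv (k0 + t)%N) (V t).
  move=> tT; split; [exact: np|exact: pV| |].
    apply: (@flim_neq0 _ G _ _ _ c c0 _ (VP t _ _)).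
    by apply: filterS (pivG t tT) => j /= <-; apply: U1.
  apply: (@flim_neq0 _ G _ _ _ c c0 _ (VP t _ _)).
  by apply: filterS (pivG t tT) => j /= <-; apply: U2.
have h0 t : (t < T)%N -> h t.+1 (piv (k0 + t)%N).1 (piv (k0 + t)%N).2 = 0.
  move=> tT; apply: (@flim_unique _ G _ _ _ _ (hP _ _ _)).
  apply: (@flim_near_eq _ G _ (fun=> 0)); last exact: flim_cst.
  by apply: filterS (pivG t tT) => j /= <-; rewrite addnS H0.
have loss t : (t < T)%N -> off2 (h t.+1) =
    off2 (h t) - 2 * nm (h t (piv (k0 + t)%N).1 (piv (k0 + t)%N).2) ^+ 2.
  by move=> tT; rewrite hS (off2_cong (np _) (pV t tT)) // -hS h0.
have hL t : off2 (h t) <= L.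
  apply/ler_addgt0Pr => e e0; have [N _ HN] := Lup e e0.
  apply: (flim_toC_le _ (off2_lim _ (hP t))).
  by apply: filterS (psi_oo t N) => j /= /HN.
have LT : L <= off2 (h T).
  apply/ler_addgt0Pr => e e0; rewrite -lerBlDr -lerN2.
  apply: (@flim_toC_le _ G _ (fun j => - off2 (H (psi j + T)%N))).
    have [N HN] : exists N : nat, e^-1 < N%:R by exists (Num.bound e^-1);
      apply: archi_boundP; rewrite invr_ge0 ltW.
    apply: ooG; exists N => // j /= Nj; rewrite psiK lerN2.
    have [_ /ltW] := phiP j; apply: le_trans; rewrite lerD2l lerN2.
    rewrite -[e]invrK lef_pV2 ?posrE ?invr_gt0 ?ltr0n //.
    by apply: le_trans (ltW HN) _; rewrite ler_nat; apply: leq_trans Nj _.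
  by rewrite toCN; under eq_fun do rewrite toCN; apply: flimN; apply: off2_lim.
have mono t d : (t + d <= T)%N -> off2 (h (t + d)%N) <= off2 (h t).
  elim: d => [|d IH]; first by rewrite addn0.
  rewrite addnS => tT; rewrite loss //; have := IH (ltnW tT).
  by have := sqr_ge0 (nm (h (t + d)%N (piv (k0 + (t + d))%N).1 (piv (k0 + (t + d))%N).2)); lra.
(* The off-norm is at most [L] at time [t], never increases up to [T], and is at least [L] there. No
   step can lose anything, so each pivot was already zero. *)
have piv0 t : (t < T)%N -> h t (piv (k0 + t)%N).1 (piv (k0 + t)%N).2 = 0.
  move=> tT; apply/nm_eq0/eqP; rewrite -sqrf_eq0 eq_le sqr_ge0 andbT.
  have := loss t tT; have := hL t; have := @mono t.+1 (T - t.+1)%N.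
  by rewrite subnKC // => /(_ (leqnn _)); lra.
have runs d : (d <= T)%N -> run (window piv (k0 + (T - d)) d) (h (T - d)%N) (h T).
  elim: d => [|d IH] dT; first by rewrite subn0.
  have tT : (T - d.+1 < T)%N by lia.
  have e : (T - d.+1).+1 = (T - d)%N by lia.
  rewrite /window /=; exists (V (T - d.+1)%N); split; [exact: rV|exact: piv0|by rewrite -hS h0|].
  by rewrite -hS e -addnS e; apply: IH; apply: ltnW.
have := runs T (leqnn T); rewrite subnn addn0 => r.
(* The forcing word makes [h 0] diagonal, so [L <= off2 (h T) <= off2 (h 0) = 0]. *)
have /offzero_off2 z := fT k0 _ _ (hh 0%N) r.
by have := @mono 0%N T (leqnn _); rewrite add0n z; lra.
Qed.

End OffNorm.

(** * One Cholesky-Jacobi step *)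

Section TwoByTwo.
Variable R : realType.
Local Notation C := R[i].
Implicit Types (M X Y : 'M[C]_2).

Lemma ord2P (P : 'I_2 -> Prop) : P c0 -> P c1 -> forall a, P a.
Proof.
by move=> P0 P1 [[|[|//]] lt]; [rewrite (_ : Ordinal lt = c0)|
  rewrite (_ : Ordinal lt = c1)] => //; apply: val_inj.
Qed.

Lemma sum2 (V : nmodType) (f : 'I_2 -> V) : \sum_a f a = f c0 + f c1.
Proof.
rewrite big_ord_recl big_ord_recl big_ord0 addr0; congr (_ + f _); exact: val_inj.
Qed.

Lemma mx2E (a b c d : C) : (mx2 a b c d c0 c0 = a) * (mx2 a b c d c0 c1 = b) *
  (mx2 a b c d c1 c0 = c) * (mx2 a b c d c1 c1 = d).
Proof. by do !split; rewrite mxE. Qed.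

Lemma mx2_eta M : M = mx2 (M c0 c0) (M c0 c1) (M c1 c0) (M c1 c1).
Proof. by apply/matrixP; apply: ord2P; apply: ord2P; rewrite mx2E. Qed.

Lemma mul_mx2 (a b c d a' b' c' d' : C) : mx2 a b c d *m mx2 a' b' c' d' =
  mx2 (a * a' + b * c') (a * b' + b * d') (c * a' + d * c') (c * b' + d * d').
Proof.
by apply/matrixP; apply: ord2P; apply: ord2P; rewrite mxE sum2 !mx2E.
Qed.

Lemma ctr_mx2 (a b c d : C) : ctrmx (mx2 a b c d) = mx2 a^* c^* b^* d^*.
Proof. by apply/matrixP; apply: ord2P; apply: ord2P; rewrite ctrmxE !mx2E. Qed.

Lemma one_mx2 : 1%:M = mx2 1 0 0 1 :> 'M[C]_2.
Proof. by apply/matrixP; apply: ord2P; apply: ord2P; rewrite mx2E mxE. Qed.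

Lemma jac_eia_unit M : jac_eia M * (jac_eia M)^* = 1.
Proof.
rewrite /jac_eia; case: eqP => [_|/eqP m0]; first by rewrite rmorph1 mulr1.
have n0 : `|M c0 c1| != 0 by rewrite normr_eq0.
by rewrite -normCK normf_div normr_id divff // expr1n.
Qed.

Lemma jac_eiaE M : M c0 c1 = toC (nm (M c0 c1)) * jac_eia M.
Proof.
rewrite /jac_eia -nmE; case: eqP => [->|/eqP m0]; first by rewrite normr0 mul0r.
by rewrite mulrC divfK // normr_eq0.
Qed.

(** The tangent condition multiplied out, so that it also holds when the diagonal entries agree. The
    bound on the cosine is [cos (2 phi) >= 0] in double-angle form. *)
Lemma jac_phi_trig M : let c := cos (jac_phi M) in let s := sin (jac_phi M) in
  complex.Re (M c0 c0 - M c1 c1) * (s * c) = nm (M c0 c1) * (c ^+ 2 - s ^+ 2) /\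
  1 / 2 <= c ^+ 2.
Proof.
move=> c s; have c2s2 : c ^+ 2 + s ^+ 2 = 1 := cos2Dsin2 _.
have c2 : cos (jac_phi M * 2) = 2 * c ^+ 2 - 1.
  by rewrite mulr_natr cos_mulr2n -mulr_natl.
have s2 : sin (jac_phi M * 2) = 2 * (c * s).
  by rewrite mulr_natr sin_mulr2n -mulr_natl.
have rE : complex.Re `|M c0 c1| = nm (M c0 c1) by [].
move: c2 s2; rewrite {1 2}/jac_phi rE; case: ifPn => [d0|].
  rewrite divfK ?pnatr_eq0 //; set d := complex.Re _; set y := _ / d.
  have c0 : 0 < cos (atan y) by apply: cos_gt0_pihalf; rewrite atan_gtNpi2 atan_ltpi2.
  have := atanK y; rewrite /tan => tE.
  have : sin (atan y) = y * cos (atan y) by rewrite -{2}tE divfK // gt_eqF.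
  move=> -> c2 s2; split; last by lra.
  have dy : d * y = 2 * nm (M Defs.c0 c1) by rewrite /y mulrC divfK.
  have : d * y * cos (atan y) = 2 * (d * (c * s)) by rewrite -mulrA s2 mulrCA.
  have -> : s ^+ 2 = 1 - c ^+ 2 by lra.
  by rewrite dy c2 (mulrC s c); lra.
rewrite negbK => /eqP ->; case: eqP => [->|_].
  rewrite mul0r cos0 sin0 nm0 mul0r => c2 s2; split; [by rewrite mul0r|lra].
have -> : pi / 4 * 2 = pi / 2 :> R by field.
rewrite cos_pihalf sin_pihalf mul0r => c2 s2; split; last lra.
have -> : c ^+ 2 - s ^+ 2 = 0 by lra.
by rewrite mulr0.
Qed.

Lemma JhatE M : Jhat M = mx2 (toC (cos (jac_phi M))) (- jac_eia M * toC (sin (jac_phi M)))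
   ((jac_eia M)^* * toC (sin (jac_phi M))) (toC (cos (jac_phi M))).
Proof. by []. Qed.

Lemma Jhat_unitary M : ctrmx (Jhat M) *m Jhat M = 1%:M.
Proof.
rewrite JhatE ctr_mx2 mul_mx2 one_mx2 !rmorphM !rmorphN /= !conjCK !conj_toC.
have e1 := jac_eia_unit M.
have cs : toC (cos (jac_phi M)) ^+ 2 + toC (sin (jac_phi M)) ^+ 2 = 1 :> C.
  by rewrite -!toCX -toCD cos2Dsin2 toC1.
move: (toC (cos _)) (toC (sin _)) (jac_eia M) ((jac_eia M)^*) cs e1 => c s e e' cs e1.
have E1 : c * c + e * s * (e' * s) = 1.
  transitivity (c ^+ 2 + (e * e') * s ^+ 2); first by ring.
  by rewrite e1 mul1r.
by congr mx2; [|ring|ring|]; rewrite -E1; ring.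
Qed.

Section Hermitian.
Variable M : 'M[C]_2.
Hypothesis hM : ctrmx M = M.

Local Notation c := (cos (jac_phi M)).
Local Notation s := (sin (jac_phi M)).
Local Notation e := (jac_eia M).
Local Notation r := (nm (M c0 c1)).
Local Notation m0 := (complex.Re (M c0 c0)).
Local Notation m1 := (complex.Re (M c1 c1)).

Lemma herm2_diag a : M a a = toC (complex.Re (M a a)).
Proof.
rewrite /toC RRe_real //; apply/CrealP.
by rewrite -[in RHS]hM ctrmxE.
Qed.

Lemma herm2E : M = mx2 (toC m0) (toC r * e) (toC r * e^*) (toC m1).
Proof.
rewrite [LHS]mx2_eta -!herm2_diag -jac_eiaE; congr mx2.
by rewrite -[in LHS]hM ctrmxE [in LHS]jac_eiaE rmorphM /= conj_toC.
Qed.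

Lemma Jhat_cong : ctrmx (Jhat M) *m M *m Jhat M =
  mx2 (toC (m0 - (m0 - m1) * s ^+ 2 + 2 * r * (s * c))) 0 0
      (toC (m1 + (m0 - m1) * s ^+ 2 - 2 * r * (s * c))).
Proof.
have [tr _] := jac_phi_trig M; rewrite raddfB /= in tr.
have c2s2 : c ^+ 2 = 1 - s ^+ 2 by rewrite -(cos2Dsin2 (jac_phi M)) addrK.
have e1 := jac_eia_unit M.
rewrite [in X in _ *m X *m _]herm2E JhatE ctr_mx2 !mul_mx2 !rmorphM !rmorphN /=.
rewrite !conjCK !conj_toC.
have off : toC ((m0 - m1) * (s * c)) = toC (r * (c ^+ 2 - s ^+ 2)) by rewrite tr.
have cc : toC c ^+ 2 = 1 - toC s ^+ 2 by rewrite -!toCX c2s2 toCD toCN toC1.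
rewrite !(toCM, toCD, toCN, toCX, toC1) in off *.
move: (toC c) (toC s) (toC r) (toC m0) (toC m1) e e^* cc off e1
  => c' s' r' p q e' f' cc off e1; congr mx2.
- transitivity (c' ^+ 2 * p + (e' * f') * (2 * r' * s' * c' + s' ^+ 2 * q)); first by ring.
  by rewrite cc e1; ring.
- transitivity (e' * (r' * (c' ^+ 2 - s' ^+ 2 * (e' * f')) - (p - q) * (s' * c'))).
    by ring.
  by rewrite e1 off; ring.
- transitivity (f' * (r' * (c' ^+ 2 - s' ^+ 2 * (e' * f')) - (p - q) * (s' * c'))).
    by ring.
  by rewrite e1 off; ring.
- transitivity (c' ^+ 2 * q + (e' * f') * (s' ^+ 2 * p - 2 * r' * s' * c')); first by ring.
  by rewrite cc e1; ring.
Qed.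

(** Each diagonal entry moves by [2 r s c - (m0 - m1) s^2] up to sign. The first term is at most [r]
    and the second at most [2 r], so 4 leaves room to spare. *)
Lemma Jhat_diag_bound :
  (nm ((ctrmx (Jhat M) *m M *m Jhat M) c0 c0 - M c0 c0) <= 4 * r) /\
  (nm ((ctrmx (Jhat M) *m M *m Jhat M) c1 c1 - M c1 c1) <= 4 * r).
Proof.
have [tr c2] := jac_phi_trig M; rewrite raddfB /= in tr.
have c2s2 := cos2Dsin2 (jac_phi M).
rewrite Jhat_cong !mx2E.
have d0 : M c0 c0 = toC m0 := herm2_diag c0.
have d1 : M c1 c1 = toC m1 := herm2_diag c1.
move: tr d0 d1; set p0 := m0; set p1 := m1 => tr -> ->.
rewrite -!toCN -!toCD !nm_toC.
have r0 := nm_ge0 (M c0 c1).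
have bsc : `|s * c| <= 1 / 2 by rewrite ler_norml; apply/andP; split; nra.
(* The gap [p0 - p1] is not small. Multiplying by [c] lets the tangent condition replace it by [r],
   and [|c| >= 1/2] allows dividing back. *)
have bd : `|(p0 - p1) * s ^+ 2| <= 2 * r.
  have e1 : `|c| * `|(p0 - p1) * s ^+ 2| = r * (`|s| * `|c ^+ 2 - s ^+ 2|).
    rewrite -normrM (_ : c * _ = (p0 - p1) * (s * c) * s); last by ring.
    by rewrite tr !normrM (ger0_norm r0); ring.
  have s1 : `|s| <= 1 by rewrite ler_norml; apply/andP; split; nra.
  have s2 : `|c ^+ 2 - s ^+ 2| <= 1 by rewrite ler_norml; apply/andP; split; nra.
  have c1 : 1 / 2 <= `|c|.
    have : `|c| ^+ 2 = c ^+ 2 by rewrite real_normK ?num_real.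
    by have := normr_ge0 c; nra.
  have : `|s| * `|c ^+ 2 - s ^+ 2| <= 1.
    by rewrite -[1]mulr1; apply: ler_pM.
  have := normr_ge0 ((p0 - p1) * s ^+ 2); nra.
move: bsc bd; rewrite !ler_norml => /andP[a1 a2] /andP[b1 b2].
by split; apply/andP; split; nra.
Qed.

End Hermitian.

End TwoByTwo.

Section Embed2.
Variables (R : realType) (n : nat) (i j : 'I_n).
Hypothesis ij : i != j.
Local Notation C := R[i].
Implicit Types (X Y : 'M[C]_2) (h : 'M[C]_n).
Local Notation E X := (embed2 X i j).

(** Addressing the pivot rows through ['I_2] reduces claims about the block to 2x2 cases. *)
Definition pivot_index (a : 'I_2) : 'I_n := if a == c0 then i else j.
Local Notation io := pivot_index.

Lemma pivot_indexP r : (exists a, r = io a) \/ outside (i, j) r.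
Proof.
case: (boolP (outside (i, j) r)) => [|/outsideN[]]; [by right|move->; left|move->; left].
  by exists c0.
by exists c1.
Qed.

Lemma pivot_index_eq a b : (io a == io b) = (a == b).
Proof.
by move: a b; apply: ord2P; apply: ord2P; rewrite /io /= ?eqxx // ?[j == i]eq_sym (negbTE ij).
Qed.

Lemma outside_pivot_index a : outside (i, j) (io a) = false.
Proof. by move: a; apply: ord2P; rewrite /outside /io /= eqxx ?andbF. Qed.

Lemma outside_neq_pivot r a : outside (i, j) r -> (r == io a) = false.
Proof.
by move=> o; apply/eqP => e; rewrite e outside_pivot_index in o.
Qed.

Lemma pivsubE h a b : pivsub h i j a b = h (io a) (io b).
Proof. by move: a b; apply: ord2P; apply: ord2P; rewrite mx2E. Qed.

Lemma embed2_plane X : plane_mx (i, j) (E X).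
Proof.
move=> r s; rewrite /outside /= mxE => /orP[/andP[/negbTE-> /negbTE->]//|].
move=> /andP[/negbTE si /negbTE sj]; rewrite si sj.
by case: eqP => [->|_]; [|case: eqP => [->|//]]; rewrite eq_sym ?si ?sj.
Qed.

Lemma embed2E X a b : E X (io a) (io b) = X a b.
Proof.
have ji : (j == i) = false by rewrite eq_sym (negbTE ij).
by move: a b; apply: ord2P; apply: ord2P; rewrite mxE /io /= ?eqxx ?ji ?eqxx.
Qed.

Lemma mul_embed2 h X l b : (h *m E X) l (io b) = \sum_a h l (io a) * X a b.
Proof.
rewrite mxE sum2 (bigD1 i) //= (bigD1 j) 1?eq_sym //= big1 ?addr0.
  by rewrite -(embed2E X c0 b) -(embed2E X c1 b).
move=> k /andP[ki kj]; have o : outside (i, j) k by rewrite /outside ki kj.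
by rewrite embed2_plane ?o // outside_neq_pivot // mulr0.
Qed.

Lemma mul_embed2_out h X l s : outside (i, j) s -> (h *m E X) l s = h l s.
Proof.
move=> o; rewrite mxE (bigD1 s) //= embed2_plane ?o ?orbT // eqxx mulr1.
rewrite big1 ?addr0 // => k ks.
by rewrite embed2_plane ?o ?orbT // (negbTE ks) mulr0.
Qed.

Lemma embed2_mul X Y : E X *m E Y = E (X *m Y).
Proof.
apply/matrixP => r s; have [[b ->]|os] := pivot_indexP s; last first.
  by rewrite mul_embed2_out // !embed2_plane ?os ?orbT.
rewrite mul_embed2; have [[a ->]|or] := pivot_indexP r.
  by rewrite embed2E mxE; apply: eq_bigr => k _; rewrite embed2E.
rewrite embed2_plane ?or // outside_neq_pivot //.
by rewrite big1 // => k _; rewrite embed2_plane ?or // outside_neq_pivot // mul0r.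
Qed.

Lemma embed2_ctr X : ctrmx (E X) = E (ctrmx X).
Proof.
apply/matrixP => r s; rewrite ctrmxE; have [[b ->]|os] := pivot_indexP s; last first.
  by rewrite !embed2_plane ?os ?orbT // conjC_nat eq_sym.
have [[a ->]|or] := pivot_indexP r; first by rewrite !embed2E ctrmxE.
by rewrite !embed2_plane ?or ?orbT // conjC_nat eq_sym.
Qed.

Lemma embed2_1 : E (1%:M : 'M[C]_2) = 1%:M.
Proof.
apply/matrixP => r s; have [[b ->]|os] := pivot_indexP s; last first.
  by rewrite embed2_plane ?os ?orbT // mxE.
have [[a ->]|or] := pivot_indexP r; last by rewrite embed2_plane ?or // mxE.
by rewrite embed2E !mxE pivot_index_eq.
Qed.

Lemma embed2_unitary X : ctrmx X *m X = 1%:M -> plane_unitary (i, j) (E X).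
Proof.
by move=> XX; split; [rewrite embed2_ctr embed2_mul XX embed2_1|exact: embed2_plane].
Qed.

Lemma pivsub_cong X h : pivsub (cong (E X) h) i j = ctrmx X *m pivsub h i j *m X.
Proof.
apply/matrixP => a b; rewrite pivsubE /cong mul_embed2 [RHS]mxE.
apply: eq_bigr => k _; congr (_ * _); rewrite [RHS]mxE.
rewrite -[ctrmx (E X) *m h]ctrmxK ctrmxE ctrmx_mul ctrmxK mul_embed2 rmorph_sum /=.
by apply: eq_bigr => l _; rewrite rmorphM /= ctrmxE conjCK ctrmxE pivsubE mulrC.
Qed.

Lemma det_embed2_lower X : (i < j)%N -> X c0 c1 = 0 -> \det (E X) = X c0 c0 * X c1 c1.
Proof.
move=> lt_ij X0; rewrite det_trig.
  rewrite (bigD1 i) //= (bigD1 j) 1?eq_sym //= mulrA big1 ?mulr1.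
    by rewrite -(embed2E X c0 c0) -(embed2E X c1 c1).
  by move=> k /andP[ki kj]; rewrite embed2_plane ?eqxx // /outside ki kj.
apply/is_trig_mxP => r s rs; have [[b e]|os] := pivot_indexP s; last first.
  by rewrite embed2_plane ?os ?orbT //; case: eqP => // e; rewrite e ltnn in rs.
have [[a e']|or] := pivot_indexP r; last first.
  by rewrite embed2_plane ?or //; case: eqP => // e'; rewrite e' ltnn in rs.
move: rs; rewrite e e' embed2E; move: a b {e e'}; apply: ord2P; apply: ord2P => //=;
  rewrite /pivot_index /= ?ltnn // => ji.
by move: (ltn_trans lt_ij ji); rewrite ltnn.
Qed.

Lemma det_embed2_upper X : (i < j)%N -> X c1 c0 = 0 -> \det (E X) = X c0 c0 * X c1 c1.
Proof.
move=> lt_ij X0; have e := det_ctrmx (E X).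
rewrite embed2_ctr det_embed2_lower // ?ctrmxE ?X0 ?rmorph0 // in e.
by apply: (can_inj (@conjCK C)); rewrite -e rmorphM.
Qed.

Lemma cong_embed2_out X h r s : outside (i, j) r -> outside (i, j) s ->
  cong (E X) h r s = h r s.
Proof. exact: cong_out (embed2_plane X). Qed.

End Embed2.

Section CholeskyFactor.
Variables (R : realType) (n : nat).
Local Notation C := R[i].

Lemma sqrtC_toC (x : R) : 0 <= x -> sqrtC (toC x) = toC (Num.sqrt x).
Proof.
move=> x0; rewrite -{1}[x]sqr_sqrtr // toCX sqrCK //.
by rewrite -toC0 toC_le sqrtr_ge0.
Qed.

(** Here [g = 1 / beta], shared by both triangular shapes. The third bound holds because
    [g (1 - beta^2) = g - beta] and [beta <= 1]; it shows that [g - 1] is quadratic in the pivot of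
    B. *)
Lemma Chat_cases (A B : 'M[C]_n) i j : nm (B i j) < 1 ->
  let b := B i j in
  exists g : R, [/\ 1 <= g, g ^+ 2 * (1 - nm b ^+ 2) = 1, g - 1 <= g * nm b ^+ 2 &
   (Chat A B i j = mx2 1 (- (toC g * b)) 0 (toC g) \/
    Chat A B i j = mx2 (toC g) 0 (- (toC g * b^*)) 1)].
Proof.
move=> b1 b; have b0 := nm_ge0 b.
have x0 : 0 < 1 - nm b ^+ 2 by rewrite -/b in b1; nra.
pose be := Num.sqrt (1 - nm b ^+ 2).
have be0 : 0 < be by rewrite sqrtr_gt0.
have be2 : be ^+ 2 = 1 - nm b ^+ 2 by rewrite sqr_sqrtr // ltW.
have beE : sqrtC (1 - `|b| ^+ 2) = toC be.
  by rewrite nmE -toCX -toC1 -toCN -toCD sqrtC_toC // ltW.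
have gb : be^-1 * be = 1 by rewrite mulVf // gt_eqF.
have g0 : 0 < be^-1 by rewrite invr_gt0.
have be1 : be <= 1 by have := sqr_ge0 (nm b); nra.
exists be^-1; split.
- by nra.
- by rewrite -be2 -exprMn gb expr1n.
- have -> : nm b ^+ 2 = 1 - be ^+ 2 by rewrite be2; ring.
  have -> : be^-1 * (1 - be ^+ 2) = be^-1 - (be^-1 * be) * be by ring.
  by rewrite gb mul1r; lra.
have gbC : toC be^-1 * toC be = 1 by rewrite -toCM gb toC1.
have iE : (toC be)^-1 = toC be^-1.
  have n0 : toC be != 0.
    by apply/eqP => z; move/eqP: gbC; rewrite z mulr0 eq_sym oner_eq0.
  by apply: (mulIf n0); rewrite gbC mulVf.
rewrite /Chat -/b beE iE; case: ifP => _; [left|right];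
  apply/matrixP; apply: ord2P; apply: ord2P; rewrite mxE !mx2E ?gbC ?mulr1 ?mulr0 ?mulrN //.
Qed.

Lemma Chat_cong (A B : 'M[C]_n) i j : nm (B i j) < 1 ->
  ctrmx (Chat A B i j) *m mx2 1 (B i j) (B i j)^* 1 *m Chat A B i j = 1%:M.
Proof.
move=> /(Chat_cases A)[g [_ g2 _ H]].
have {}g2 : toC g ^+ 2 * (1 - B i j * (B i j)^*) = 1.
  by rewrite -nm_sqr -toCX -toC1 -toCN -toCD -toCM g2.
case: H => ->; rewrite ctr_mx2 !mul_mx2 one_mx2 ?rmorphN ?rmorphM ?rmorph1 ?rmorph0 /=
  ?conjCK ?conj_toC; move: (B i j) (B i j)^* (toC g) g2 => b b' g' g2;
  by congr mx2; first [ring|rewrite -[RHS]g2; ring].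
Qed.

Lemma nm_det_Chat (A B : 'M[C]_n) (i j : 'I_n) : (i < j)%N -> nm (B i j) < 1 ->
  nm (\det (embed2 (Chat A B i j) i j)) ^+ 2 * (1 - nm (B i j) ^+ 2) = 1.
Proof.
move=> ij /(Chat_cases A)[g [_ g2 _ H]].
have nij : i != j by rewrite neq_ltn ij.
have E : \det (embed2 (Chat A B i j) i j) = toC g.
  case: H => ->.
    by rewrite det_embed2_upper // !mx2E // mul1r.
  by rewrite det_embed2_lower // !mx2E // mulr1.
by rewrite E nm_toC real_normK ?num_real.
Qed.

Lemma Chat_near1 (A B : 'M[C]_n) i j r s : i != j -> nm (B i j) <= 1 / 2 ->
  nm (embed2 (Chat A B i j) i j r s - 1%:M r s) <= 2 * nm (B i j).
Proof.
move=> ij b2; have b1 : nm (B i j) < 1 by lra.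
have [g [g1 g2 g3 H]] := Chat_cases A b1.
have b0 := nm_ge0 (B i j).
have b4 : nm (B i j) ^+ 2 <= 1 / 4 by nra.
(* For a pivot of size at most 1/2, [g^2 <= 4/3]; hence [g <= 2], which gives the factor 2 for all
   entries of the block. *)
have g2' : g ^+ 2 * (3 / 4) <= 1.
  by rewrite -[X in _ <= X]g2; apply: ler_wpM2l; [exact: sqr_ge0|lra].
have g4 : g <= 2 by nra.
have g5 : g - 1 <= 2 * nm (B i j).
  apply: le_trans g3 _; have : g * nm (B i j) ^+ 2 <= 2 * nm (B i j) ^+ 2.
    by apply: ler_wpM2r => //; apply: sqr_ge0.
  by nra.
have ng : nm (toC g - 1) <= 2 * nm (B i j).
  by rewrite -toC1 -toCN -toCD nm_toC ger0_norm //; lra.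
have gb : nm (- (toC g * B i j)) <= 2 * nm (B i j).
  by rewrite nmN nmM nm_toC ger0_norm; nra.
have gb' : nm (- (toC g * (B i j)^*)) <= 2 * nm (B i j).
  by rewrite nmN nmM nm_conj nm_toC ger0_norm; nra.
have z : nm 0 <= 2 * nm (B i j) by rewrite nm0; lra.
have [[b ->]|os] := pivot_indexP i j s; last first.
  by rewrite (embed2_plane _ ) ?os ?orbT // mxE subrr.
have [[a ->]|or] := pivot_indexP i j r; last first.
  by rewrite (embed2_plane _ ) ?or // mxE subrr.
rewrite (embed2E ij) mxE (pivot_index_eq ij).
by case: H => ->; move: a b; apply: ord2P; apply: ord2P; rewrite !mx2E /= ?subrr ?subr0.
Qed.

End CholeskyFactor.

(** * Boundedness *)

Section PositiveDefinite.
Variables (R : realType) (n : nat).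
Local Notation C := R[i].
Implicit Types (B F : 'M[C]_n) (x y z : 'cV[C]_n).

Definition form B x y : C := (ctrmx x *m B *m y) ord0 ord0.

Lemma form_conj B x y : herm_mx B -> form B y x = (form B x y)^*.
Proof. by move=> hB; rewrite /form -ctrmxE !ctrmx_mul ctrmxK hB mulmxA. Qed.

Lemma formBr B x y z : form B x (y - z) = form B x y - form B x z.
Proof. by rewrite /form mulmxBr !mxE. Qed.

Lemma formZr B x y a : form B x (a *: y) = a * form B x y.
Proof. by rewrite /form -scalemxAr mxE. Qed.

Lemma formBl B x y z : herm_mx B -> form B (x - y) z = form B x z - form B y z.
Proof. by move=> hB; rewrite !(form_conj z _ hB) formBr rmorphB. Qed.

Lemma formZl B x y a : herm_mx B -> form B (a *: x) y = a^* * form B x y.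
Proof. by move=> hB; rewrite !(form_conj y _ hB) formZr rmorphM. Qed.

Lemma ctr_delta r : ctrmx (delta_mx r 0 : 'cV[C]_n) = delta_mx 0 r.
Proof. by apply/matrixP => a b; rewrite ctrmxE !mxE conjC_nat andbC. Qed.

Lemma form_delta B r s : form B (delta_mx r 0) (delta_mx s 0) = B r s.
Proof. by rewrite /form ctr_delta -rowE -colE !mxE. Qed.

Lemma form_cong B F x y : form (cong F B) x y = form B (F *m x) (F *m y).
Proof. by rewrite /form ctrmx_mul !mulmxA. Qed.

Lemma posdef_unit B : posdef_mx B -> B \in unitmx.
Proof.
move=> pB; rewrite unitmxE unitfE; apply/det0P => -[v v0 vB].
have x0 : ctrmx v != 0.
  by apply: contraNneq v0 => e; rewrite -[v]ctrmxK e; apply/eqP/matrixP => a b;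
     rewrite ctrmxE !mxE rmorph0.
by have := pB _ x0; rewrite ctrmxK vB mul0mx mxE ltxx.
Qed.

Lemma posdef_cong B F : posdef_mx B -> F \in unitmx -> posdef_mx (cong F B).
Proof.
move=> pB uF x x0; rewrite -/(form _ x x) form_cong; apply: pB.
by apply: contraNneq x0 => e; rewrite -(mulKmx uF x) e mulmx0.
Qed.

Lemma form_ge0 B x : posdef_mx B -> 0 <= form B x x.
Proof.
move=> pB; have [->|x0] := eqVneq x 0; last exact: ltW (pB _ x0).
by rewrite /form mulmx0 mxE.
Qed.

Lemma form_cauchy B x y : herm_mx B -> posdef_mx B ->
  form B x y * (form B x y)^* <= form B x x * form B y y.
Proof.
move=> hB pB; have [->|y0] := eqVneq y 0.
  by rewrite /form !mulmx0 !mxE !(mul0r, mulr0).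
have c0 : 0 < form B y y := pB _ y0.
have cr : (form B y y)^* = form B y y by rewrite -form_conj.
(* This vector is a multiple of the part of [x] that is B-orthogonal to [y], scaled to avoid
   division; its form is [form B y y] times the desired difference. *)
have := form_ge0 (form B y y *: x - form B y x *: y) pB.
rewrite formBr !formZr !formBl // !formZl // (form_conj x y hB) cr conjCK.
set f := form B x y; set a := form B x x; set c := form B y y => H.
rewrite -subr_ge0 -(pmulr_rge0 _ c0) -/c.
by move: H; congr (_ <= _); ring.
Qed.

(** Each column of [F] has B-norm 1, and pairing it with [B^-1 e_r] through B recovers the entry
    [F r s]. Cauchy-Schwarz bounds its square by [q r], the r-th diagonal entry of [B^-1]; and
    [x^2 <= q] implies [x <= 1 + q]. *)
Lemma posdef_factor_bounded B : herm_mx B -> posdef_mx B ->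
  exists M : R, forall F, (forall s, cong F B s s = 1) -> forall r s, nm (F r s) <= M.
Proof.
move=> hB pB; have uB := posdef_unit pB.
have le_sum (f : 'I_n -> R) : (forall r, 0 <= f r) -> forall r, f r <= \sum_r f r.
  by move=> f0 r; rewrite (bigD1 r) //= lerDl; apply: sumr_ge0.
pose x r : 'cV[C]_n := invmx B *m delta_mx r 0.
pose q r := complex.Re (form B (x r) (x r)).
have q0 r : 0 <= q r.
  by have := form_ge0 (x r) pB; rewrite lecE => /andP[].
exists (1 + \sum_r q r) => F F1 r s.
have e : form B (x r) (F *m delta_mx s 0) = F r s.
  have iB : ctrmx (invmx B) *m B = 1%:M.
    by rewrite -[X in _ *m X]hB -ctrmx_mul mulmxV // ctrmx1.
  rewrite /form /x ctrmx_mul -[ctrmx _ *m _ *m B]mulmxA iB mulmx1.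
  by rewrite -colE ctr_delta -rowE !mxE.
have := form_cauchy (x r) (F *m delta_mx s 0) hB pB.
rewrite e -form_cong form_delta F1 mulr1 -nm_sqr lecE => /andP[_].
rewrite -/(q r) [complex.Re (toC _)]/= => h.
have := le_sum q q0 r.
by have := nm_ge0 (F r s); nra.
Qed.

Lemma posdef_offdiag_lt1 B r s : herm_mx B -> posdef_mx B ->
  (forall k, B k k = 1) -> r != s -> nm (B r s) < 1.
Proof.
(* This vector is [e_s] minus its B-projection on [e_r]; its form is [1 - |B r s|^2]. *)
move=> hB pB B1 rs; pose x : 'cV[C]_n := delta_mx s 0 - B r s *: delta_mx r 0.
have x0 : x != 0.
  apply/eqP => /matrixP/(_ s ord0); rewrite !mxE eqxx [s == r]eq_sym (negbTE rs) /=.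
  by move/eqP; rewrite mulr0 subr0 oner_eq0.
have := pB _ x0; rewrite -/(form B x x) /x formBr !formZr !formBl // !formZl //.
rewrite !form_delta !B1 (hermE r s hB) mulr1 subrr mulr0 subr0 mulrC -nm_sqr.
rewrite -toC1 -toCN -toCD -toC0 toC_lt.
by have := nm_ge0 (B r s); nra.
Qed.

Lemma nm_sum (I : Type) (r : seq I) (P : pred I) (f : I -> C) :
  nm (\sum_(a <- r | P a) f a) <= \sum_(a <- r | P a) nm (f a).
Proof. by rewrite -toC_le toC_sum -nmE; apply: ler_norm_sum. Qed.

Lemma nm_prod (I : Type) (r : seq I) (P : pred I) (f : I -> C) :
  nm (\prod_(a <- r | P a) f a) = \prod_(a <- r | P a) nm (f a).
Proof. by elim/big_rec2: _ => [|a x y _ <-]; rewrite ?nm1 ?nmM. Qed.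

(** Term by term in the Leibniz formula this gives n!. Any bound independent of the step suffices
    for the monotone determinant argument. *)
Lemma nm_det_le (M : 'M[C]_n) : (forall r s, nm (M r s) <= 1) ->
  nm (\det M) <= \sum_(s : 'S_n) 1.
Proof.
move=> M1; apply: le_trans (nm_sum _ _ _) _; apply: ler_sum => s _.
rewrite nmM nm_prod (_ : nm _ = 1) ?mul1r; last first.
  by apply: toC_inj; rewrite -nmE normr_sign toC1.
by apply: prodr_ile1 => r _; rewrite nm_ge0 M1.
Qed.

End PositiveDefinite.

(** * The Cholesky-Jacobi sequence *)

Section Sequence.
Variables (R : realType) (n : nat).
Local Notation C := R[i].
Local Notation pair := ('I_n * 'I_n)%type.
Variables (A B : 'M[C]_n) (piv : nat -> pair).
Hypotheses (hA : herm_mx A) (hB : herm_mx B) (pB : posdef_mx B).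
Hypothesis piv_lt : forall k, ((piv k).1 < (piv k).2)%N.

Definition seqA k := (cj_seq A B piv k).1.
Definition seqB k := (cj_seq A B piv k).2.
Local Notation i k := (piv k).1.
Local Notation j k := (piv k).2.

Definition chol2 k : 'M[C]_2 := Chat (seqA k) (seqB k) (i k) (j k).
Definition jacM k : 'M[C]_2 := ctrmx (chol2 k) *m pivsub (seqA k) (i k) (j k) *m chol2 k.
Definition chol k : 'M[C]_n := embed2 (chol2 k) (i k) (j k).
Definition jrot k : 'M[C]_n := embed2 (Jhat (jacM k)) (i k) (j k).

Lemma piv_neq k : i k != j k.
Proof. by rewrite neq_ltn piv_lt. Qed.

Lemma cj_ZE k : cj_Z (seqA k) (seqB k) (i k) (j k) = chol k *m jrot k.
Proof. by rewrite embed2_mul ?piv_neq. Qed.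

Lemma seqA_step k : seqA k.+1 = cong (chol k *m jrot k) (seqA k).
Proof. by rewrite -cj_ZE. Qed.

Lemma seqB_step k : seqB k.+1 = cong (chol k *m jrot k) (seqB k).
Proof. by rewrite -cj_ZE. Qed.

(** Both sequences are congruences of the original pair by this one accumulated matrix, which gives
    boundedness and ties every A_k, B_k to the original pencil. *)
Fixpoint factor k : 'M[C]_n :=
  if k is k'.+1 then factor k' *m (chol k' *m jrot k') else scaleD B.

Lemma diagB_gt0 r : 0 < B r r.
Proof.
rewrite -form_delta; apply: pB; apply/eqP => /matrixP/(_ r 0); rewrite !mxE !eqxx.
by move/eqP; rewrite oner_eq0.
Qed.

Lemma ctr_scaleD : ctrmx (scaleD B) = scaleD B.
Proof.
apply/matrixP => r s; rewrite ctrmxE !mxE eq_sym; case: eqP => [->|_]; last exact: rmorph0.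
rewrite !mulr1n; apply/CrealP; rewrite realV ger0_real // sqrtC_ge0.
exact: ltW (diagB_gt0 _).
Qed.

Lemma seqA_factor k : seqA k = cong (factor k) A.
Proof.
elim: k => [|k IH]; first by rewrite /cong /= ctr_scaleD.
by rewrite seqA_step IH cong_mul.
Qed.

Lemma seqB_factor k : seqB k = cong (factor k) B.
Proof.
elim: k => [|k IH]; first by rewrite /cong /= ctr_scaleD.
by rewrite seqB_step IH cong_mul.
Qed.

Lemma seqA_herm k : herm_mx (seqA k).
Proof. by rewrite seqA_factor; apply: herm_cong. Qed.

Lemma seqB_herm k : herm_mx (seqB k).
Proof. by rewrite seqB_factor; apply: herm_cong. Qed.

Lemma jrot_unitary k : plane_unitary (piv k) (jrot k).
Proof.
have := embed2_unitary (piv_neq k) (Jhat_unitary (jacM k)).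
by rewrite -surjective_pairing.
Qed.

Lemma jrot_diag k : (1 / 2 <= nm (jrot k (i k) (i k))) /\ (1 / 2 <= nm (jrot k (j k) (j k))).
Proof.
have [_ c2] := jac_phi_trig (jacM k).
have h : 1 / 2 <= nm (toC (cos (jac_phi (jacM k)))).
  rewrite nm_toC; move: c2; rewrite -real_normK ?num_real //.
  by have := normr_ge0 (cos (jac_phi (jacM k))); nra.
have E a := embed2E (piv_neq k) (Jhat (jacM k)) a a.
by split; [have := E c0|have := E c1]; rewrite -/(jrot k) /= => ->; rewrite JhatE !mx2E.
Qed.

Lemma nm_det_jrot k : nm (\det (jrot k)) = 1.
Proof.
have [UU _] := jrot_unitary k; have := congr1 determinant UU.
rewrite det_mulmx det_ctrmx det1 mulrC -nm_sqr -toC1 => /toC_inj.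
by have := nm_ge0 (\det (jrot k)); nra.
Qed.

Lemma jacM_herm k : ctrmx (jacM k) = jacM k.
Proof.
rewrite /jacM !ctrmx_mul ctrmxK mulmxA; congr (_ *m _ *m _).
by rewrite ctr_mx2 -!(hermE _ _ (seqA_herm k)).
Qed.

Lemma pivsub_seqA k : pivsub (seqA k.+1) (i k) (j k) =
  ctrmx (Jhat (jacM k)) *m jacM k *m Jhat (jacM k).
Proof.
by rewrite seqA_step -cong_mul !pivsub_cong ?piv_neq.
Qed.

Lemma seqA_pivot k : seqA k.+1 (i k) (j k) = 0.
Proof.
have := congr1 (fun M : 'M[C]_2 => M c0 c1) (pivsub_seqA k).
by rewrite (Jhat_cong (jacM_herm k)) !mx2E.
Qed.

Lemma pivsub_seqB k : (forall r, seqB k r r = 1) -> nm (seqB k (i k) (j k)) < 1 ->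
  pivsub (seqB k.+1) (i k) (j k) = 1%:M.
Proof.
move=> B1 b1; rewrite seqB_step -cong_mul !pivsub_cong ?piv_neq //.
have -> : pivsub (seqB k) (i k) (j k) =
    mx2 1 (seqB k (i k) (j k)) (seqB k (i k) (j k))^* 1.
  by rewrite /pivsub !B1 -(hermE _ _ (seqB_herm k)).
by rewrite Chat_cong // mulmx1 Jhat_unitary.
Qed.

(** Invertibility of the factor and the unit diagonal must be proved together: a step is a genuine
    Cholesky step only if its pivot of B is below 1, which needs positive definiteness and the unit
    diagonal at the previous stage. *)
Lemma seqB_spec k : factor k \in unitmx /\ (forall r, seqB k r r = 1) /\
   (forall r s, r != s -> nm (seqB k r s) < 1).
Proof.
suff [uF B1] : factor k \in unitmx /\ (forall r, seqB k r r = 1).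
  split=> //; split=> // r s; apply: posdef_offdiag_lt1 => //; first exact: seqB_herm.
  by rewrite seqB_factor; apply: posdef_cong.
elim: k => [|k [uF B1]].
  have b0 r : sqrtC (B r r) != 0 by rewrite sqrtC_eq0 gt_eqF // diagB_gt0.
  split.
    rewrite /= unitmxE unitfE det_diag; apply/prodf_neq0 => r _.
    by rewrite mxE invr_eq0.
  move=> r; rewrite /seqB /= /scaleD mul_diag_mx mul_mx_diag !mxE.
  by rewrite -{2}(sqrtCK (B r r)); field.
have b1 : nm (seqB k (i k) (j k)) < 1.
  apply: posdef_offdiag_lt1 (piv_neq k) => //; first exact: seqB_herm.
  by rewrite seqB_factor; apply: posdef_cong.
split.
  rewrite /= !unitmx_mul uF /=; apply/andP; split; rewrite unitmxE unitfE.
    have := nm_det_Chat (seqA k) (piv_lt k) b1; apply: contra_eqN => /eqP z.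
    by rewrite [\det _]z nm0 expr0n mul0r eq_sym oner_eq0.
  apply/eqP => z; have := nm_det_jrot k; rewrite z nm0 => /eqP.
  by rewrite eq_sym oner_eq0.
have P := pivsub_seqB B1 b1.
move=> r; have [[a ->]|o] := pivot_indexP (i k) (j k) r.
  by rewrite -pivsubE P mxE eqxx.
by rewrite seqB_step embed2_mul ?piv_neq // cong_embed2_out.
Qed.

Lemma seqB_pivot k : seqB k.+1 (i k) (j k) = 0.
Proof.
have [_ [B1 lt1]] := seqB_spec k.
have := congr1 (fun M : 'M[C]_2 => M c0 c1) (pivsub_seqB B1 (lt1 _ _ (piv_neq k))).
by rewrite /pivsub mx2E => ->; rewrite mxE.
Qed.

Lemma seqB_le1 k r s : nm (seqB k r s) <= 1.
Proof.
have [_ [B1 lt1]] := seqB_spec k.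
by case: (eqVneq r s) => [->|/lt1/ltW//]; rewrite B1 nm1.
Qed.

Lemma seqB_bounded : bounded_mx seqB.
Proof. by exists 1 => k r s; apply: seqB_le1. Qed.

(** The unit diagonal of B_k bounds the accumulated factors, hence A_k, although the steps are not
    unitary. *)
Lemma seqA_bounded : bounded_mx seqA.
Proof.
have [M FM] := posdef_factor_bounded hB pB.
have {}FM k r s : nm (factor k r s) <= M.
  by apply: FM => t; rewrite -seqB_factor; have [_ [->]] := seqB_spec k.
exists (\sum_p (\sum_q M * nm (A q p)) * M) => k r s.
rewrite seqA_factor /cong mxE; apply: le_trans (nm_sum _ _ _) _.
apply: ler_sum => p _; rewrite nmM; apply: ler_pM; rewrite ?nm_ge0 //.
rewrite mxE; apply: le_trans (nm_sum _ _ _) _; apply: ler_sum => q _.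
by rewrite ctrmxE nmM nm_conj; apply: ler_wpM2r; rewrite ?nm_ge0.
Qed.

Local Open Scope classical_set_scope.

(* The Hadamard-type argument: [|det B_k|] increases by the factor
   [1 / (1 - |b_k|^2)] and stays bounded. *)
Lemma pivotB_cvg0 : flim \oo (fun k => seqB k (i k) (j k)) 0.
Proof.
pose D k := nm (\det (seqB k)).
pose b k := nm (seqB k (i k) (j k)).
have b1 k : b k < 1 by have [_ [_ lt1]] := seqB_spec k; apply: lt1; apply: piv_neq.
have DS k : D k = D k.+1 * (1 - b k ^+ 2).
  rewrite /D seqB_step /cong !det_mulmx det_ctrmx det_mulmx !nmM nm_conj nmM nm_det_jrot.
  have := nm_det_Chat (seqA k) (piv_lt k) (b1 k); rewrite -/(chol k) -/(b k) => e.
  rewrite !mulr1 mulrAC -mulrA [X in _ = X]mulrC -[LHS]mul1r -[X in X * _]e; ring.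
have D0 k : 0 <= D k := nm_ge0 _.
have Dpos : 0 < D 0%N.
  rewrite lt_neqAle D0 andbT eq_sym; apply/eqP => /nm_eq0/eqP.
  apply/negP; rewrite -unitfE -unitmxE; have [uF _] := seqB_spec 0.
  by rewrite seqB_factor; apply: posdef_unit; apply: posdef_cong.
have Dinc k : D k <= D k.+1.
  by rewrite {1}DS; have := D0 k.+1; have := sqr_ge0 (b k); nra.
have Dmono k l : D k <= D (k + l)%N.
  by elim: l => [|l IH]; rewrite ?addn0 ?addnS //; apply: le_trans (Dinc _).
pose E : set R := [set D k | k in [set: nat]].
have supE : has_sup E.
  split; first by exists (D 0%N); exists 0%N.
  exists (\sum_(s : 'S_n) 1) => _ [k _ <-]; apply: nm_det_le => r s.
  exact: seqB_le1.
(* Past [N] the determinant is within [e^2 * D 0] of its supremum. One step gains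
   [D k.+1 * b k ^+ 2], and [D 0 <= D k.+1], so [b k < e]. *)
move=> e e0; have e2 : 0 < e ^+ 2 * D 0%N by rewrite mulr_gt0 ?exprn_gt0.
have [_ [N _ <-] DN] := sup_adherent e2 supE.
exists N => // k /= Nk; rewrite subr0 -/(b k).
have : D k.+1 <= sup E by apply: (ub_le_sup (proj2 supE)); exists k.+1.
have : D N <= D k by rewrite -(subnKC Nk); apply: Dmono.
have := DS k; have := Dmono 0%N k.+1; rewrite add0n.
have := nm_ge0 (seqB k (i k) (j k)); rewrite -/(b k) => b0 h1 h2 h3 h4.
have : D 0%N * b k ^+ 2 <= D k.+1 * b k ^+ 2 by apply: ler_wpM2r => //; apply: sqr_ge0.
move=> h5; have : D 0%N * b k ^+ 2 < D 0%N * e ^+ 2 by lra.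
rewrite ltr_pM2l // => h; nra.
Qed.

Lemma chol_cvg1 : mlim (F := \oo) chol 1%:M.
Proof.
move=> r s e e0; have h2 : 0 < Num.min (1 / 2) (e / 2) :> R by rewrite lt_min; lra.
apply: filterS (pivotB_cvg0 h2) => k /=; rewrite subr0 lt_min => /andP[a b].
have := Chat_near1 (seqA k) r s (piv_neq k) (ltW a).
rewrite -/(chol2 k) -/(chol k) => h; apply: le_lt_trans h _; lra.
Qed.

End Sequence.

(** * Convergence of the diagonal *)

Section ClusterPoints.
Variable R : realType.
Local Notation C := R[i].
Local Open Scope classical_set_scope.

(** Indices violating the limit could be chosen arbitrarily far out, and an ultrafilter limit along
    them would be a contradiction. It allows A_k, so far only known to be bounded, to be treated as
    convergent. *)
Lemma flim_oo_ultra (u : nat -> C) l :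
  (forall phi : nat -> nat, (forall m, (m <= phi m)%N) ->
   forall G, UltraFilter G -> \oo `<=` G -> flim G (fun m => u (phi m)) l) ->
  flim \oo u l.
Proof.
move=> H e e0; apply: contrapT => nH.
have ex m : exists k, (m <= k)%N /\ e <= nm (u k - l).
  apply: contrapT => nex; apply: nH; exists m => // k /= mk.
  by rewrite ltNge; apply/negP => ek; apply: nex; exists k.
have [phi phiP] := choice ex.
have [G [UG ooG]] := @ultraFilterLemma nat \oo _.
have [m /=] := filter_ex (H phi (fun m => proj1 (phiP m)) G UG ooG e e0).
by have [_] := phiP m; lra.
Qed.

Lemma prod_cvg0_near (u : nat -> C) (rs : seq C) :
  flim \oo (fun k => \prod_(z <- rs) (u k - z)) 0 ->
  forall e, 0 < e -> \oo [set k | exists2 z, z \in rs & nm (u k - z) < e].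
Proof.
move=> H e e0; apply: filterS (H _ (exprn_gt0 (size rs) e0)) => k /=.
rewrite subr0 nm_prod => lt; apply: contrapT => nex.
have ge z : z \in rs -> e <= nm (u k - z).
  by move=> zr; rewrite leNgt; apply/negP => ?; apply: nex; exists z.
suff : e ^+ size rs <= \prod_(z <- rs) nm (u k - z) by lra.
elim: rs ge {H lt nex} => [|z rs IH] ge; first by rewrite big_nil expr0.
rewrite big_cons exprS; apply: ler_pM; rewrite ?exprn_ge0 ?(ltW e0) //.
  by apply: ge; rewrite inE eqxx.
by apply: IH => y yr; apply: ge; rewrite inE yr orbT.
Qed.

Lemma seq_separated (xs : seq C) :
  exists2 d : R, 0 < d & forall x, x \in xs -> nm x < d -> x = 0.
Proof.
elim: xs => [|x xs [d d0 dP]]; first by exists 1.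
have [x0|x0] := eqVneq x 0.
  by exists d => // y; rewrite inE => /orP[/eqP->//|]; apply: dP.
have nx : 0 < nm x.
  rewrite lt_neqAle nm_ge0 andbT eq_sym.
  by apply: contraNneq x0 => /nm_eq0 ->.
exists (Num.min d (nm x)); first by rewrite lt_min d0.
move=> y; rewrite inE lt_min => /orP[/eqP->|yx] /andP[]; last by move=> h _; apply: dP.
by rewrite ltxx.
Qed.

Lemma cluster_cvg (u : nat -> C) (rs : seq C) :
  flim \oo (fun k => \prod_(z <- rs) (u k - z)) 0 ->
  flim \oo (fun k => u k.+1 - u k) 0 -> exists l, flim \oo u l.
Proof.
move=> /prod_cvg0_near near step.
have [d d0 dP] := seq_separated [seq z - z' | z <- rs, z' <- rs].
have {}dP z z' : z \in rs -> z' \in rs -> nm (z - z') < d -> z = z'.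
  move=> zr zr' h; apply/eqP; rewrite -subr_eq0; apply/eqP; apply: dP h.
  by apply: allpairs_f.
(* Since [d] is at most the gap between distinct roots, three distances below [d / 3] (root to
   iterate, one step, iterate to root) force the two roots to coincide: the sequence cannot change
   root. *)
have d3 : 0 < d / 3 by lra.
have [N _ NP] := filterI (near _ d3) (step _ d3).
have [z zr uz] := proj1 (NP N (leqnn N)).
have close m : nm (u (N + m)%N - z) < d / 3.
  elim: m => [|m IH]; first by rewrite addn0.
  have [_ /=] := NP (N + m)%N (leq_addr _ _); rewrite subr0 => s.
  have [[z' z'r uz'] _] := NP (N + m.+1)%N (leq_addr _ _).
  suff -> : z = z' by [].
  apply: dP => //; rewrite addnS in uz'.
  have := nm_triangle z (u (N + m)%N) z'; rewrite (nmB z (u (N + m)%N)).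
  have := nm_triangle (u (N + m)%N) (u (N + m).+1) z'.
  rewrite (nmB (u (N + m)%N) (u (N + m).+1)); lra.
exists z => e e0; have m0 : 0 < Num.min e (d / 3) by rewrite lt_min e0.
apply: filterS2 (near _ m0) (_ : \oo [set k | (N <= k)%N]); last by exists N.
move=> k /= [z' z'r]; rewrite lt_min => /andP[a b] Nk.
suff -> : z = z' by [].
apply: dP => //; have := close (k - N)%N; rewrite subnKC // => c.
by have := nm_triangle z (u k) z'; rewrite (nmB z (u k)); lra.
Qed.

Lemma poly_eval_inj (p q : {poly C}) : (forall x, p.[x] = q.[x]) -> p = q.
Proof.
move=> pq; apply/eqP; rewrite -subr_eq0; apply/eqP.
set f := p - q; have f0 x : f.[x] = 0 by rewrite hornerD hornerN pq subrr.
apply/eqP; apply: contraT => nf.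
have := max_poly_roots nf (rs := [seq m%:R | m <- iota 0 (size f)]).
rewrite size_map size_iota ltnn; apply.
  by apply/allP => x _; rewrite /root f0.
rewrite map_inj_uniq ?iota_uniq // => a b /eqP.
by rewrite eqr_nat => /eqP.
Qed.

End ClusterPoints.

(** * The characteristic polynomial of the pencil under congruence *)

Section Pencil.
Variables (R : realType) (n : nat).
Local Notation C := R[i].
Implicit Types (A B F : 'M[C]_n).

Definition pencil A B : {poly C} := \det ('X *: map_mx polyC B - map_mx polyC A).

Lemma pencilE A B x : (pencil A B).[x] = \det (x *: B - A).
Proof.
rewrite -horner_evalE -det_map_mx; congr (\det _); apply/matrixP => r s.
by rewrite !mxE /= horner_evalE !hornerE.
Qed.

Lemma pencil_neq0 A B : B \in unitmx -> pencil A B != 0.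
Proof.
move=> uB; have -> : pencil A B = (\det B)%:P * char_poly (invmx B *m A).
  rewrite /char_poly -det_map_mx -det_mulmx; congr (\det _).
  rewrite /char_poly_mx mulmxBr -map_mxM mulmxA mulmxV // mul1mx.
  by rewrite mul_mx_scalar.
rewrite mulf_neq0 ?polyC_eq0 -?unitfE -?unitmxE //.
exact/monic_neq0/char_poly_monic.
Qed.

(** Both sides are [|det F|^2 * det B * det (x B - A)]; multiplying crosswise avoids any division by
    determinants. *)
Lemma pencil_cong A B F x :
  \det (x *: cong F B - cong F A) * \det B = \det (cong F B) * (pencil A B).[x].
Proof.
have -> : x *: cong F B - cong F A = cong F (x *: B - A).
  by rewrite /cong mulmxBr mulmxBl -scalemxAr -scalemxAl.
by rewrite pencilE /cong !det_mulmx; ring.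
Qed.

End Pencil.

Section Convergence.
Variables (R : realType) (n : nat).
Local Notation C := R[i].
Local Notation pair := ('I_n * 'I_n)%type.
Variables (A B : 'M[C]_n) (piv : nat -> pair) (T : nat).
Hypotheses (hA : herm_mx A) (hB : herm_mx B) (pB : posdef_mx B).
Hypothesis piv_lt : forall k, ((piv k).1 < (piv k).2)%N.
Hypothesis forcing_piv : forall k, forcing R (window piv k T).
Local Notation i k := (piv k).1.
Local Notation j k := (piv k).2.
Local Notation seqA := (seqA A B piv).
Local Notation seqB := (seqB A B piv).
Local Notation chol := (chol A B piv).
Local Notation jrot := (jrot A B piv).
Local Open Scope classical_set_scope.

Lemma seqA_off r s : r != s -> flim \oo (fun k => seqA k r s) 0.
Proof.
move=> rs; apply: (@offdiag_cvg0 R n seqA (fun k => chol k *m jrot k) chol jrot piv T (1 / 2)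
  _ _ _ _ _ _ _ _ _ _ _ _ r s rs) => //.
- exact: seqA_bounded.
- exact: seqA_herm.
- exact: seqA_step.
- exact: chol_cvg1.
- exact: piv_neq.
- exact: jrot_unitary.
- lra.
- by move=> k; have [] := jrot_diag A B piv_lt k.
- by move=> k; have [] := jrot_diag A B piv_lt k.
- exact: seqA_pivot.
Qed.

Lemma seqB_off r s : r != s -> flim \oo (fun k => seqB k r s) 0.
Proof.
move=> rs; apply: (@offdiag_cvg0 R n seqB (fun k => chol k *m jrot k) chol jrot piv T (1 / 2)
  _ _ _ _ _ _ _ _ _ _ _ _ r s rs) => //.
- exact: seqB_bounded.
- exact: seqB_herm.
- exact: seqB_step.
- exact: chol_cvg1.
- exact: piv_neq.
- exact: jrot_unitary.
- lra.
- by move=> k; have [] := jrot_diag A B piv_lt k.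
- by move=> k; have [] := jrot_diag A B piv_lt k.
- exact: seqB_pivot.
Qed.

Lemma seqB_cvg1 : mlim (F := \oo) seqB 1%:M.
Proof.
move=> r s; rewrite mxE; case: (eqVneq r s) => [<-|/seqB_off//].
have -> : (fun k => seqB k r r) = fun=> 1.
  by apply/funext => k; have [_ [->]] := seqB_spec A hB pB piv_lt k.
exact: flim_cst.
Qed.

Lemma chol_error_cvg0 : mlim (F := \oo) (fun k => cong (chol k) (seqA k) - seqA k) 0.
Proof.
move=> r s; apply: flim_oo_ultra => phi phiP G UG ooG; rewrite mxE.
have [M AM] := seqA_bounded A hB pB piv_lt.
have [a aP] : exists a, mlim (F := G) (fun m => seqA (phi m)) a.
  by apply: ultra_mlim; exists M => m p q; apply: AM.
have phi_oo N : G [set m | (N <= phi m)%N].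
  by apply: ooG; exists N => // m /= Nm; apply: leq_trans (phiP m).
have cP : mlim (F := G) (fun m => chol (phi m)) 1%:M.
  move=> p q; exact: (flim_subseq phi_oo (chol_cvg1 A hB pB piv_lt p q)).
under eq_fun do rewrite mxE [X in _ + X]mxE.
rewrite -(subrr (a r s)); apply: flimB (aP r s).
have := mlim_cong cP aP; rewrite cong1; exact.
Qed.

Lemma diag_step_cvg0 r : flim \oo (fun k => seqA k.+1 r r - seqA k r r) 0.
Proof.
pose E k := cong (chol k) (seqA k) - seqA k.
pose de k := \sum_p \sum_q nm (E k p q).
pose et k := \sum_p \sum_(q | q != p) nm (seqA k p q).
have toC_nm (u : nat -> C) : flim \oo u 0 -> flim \oo (fun k => toC (nm (u k))) 0.
  apply: (@flim_squeeze _ _ _ _ _ 1) => k.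
  by rewrite nm_toC ger0_norm ?nm_ge0 // mul1r.
have sum0 (P : 'I_n -> pred 'I_n) (u : 'I_n -> 'I_n -> nat -> C) :
    (forall p q, P p q -> flim \oo (u p q) 0) ->
    flim \oo (fun k => toC (\sum_p \sum_(q | P p q) nm (u p q k))) 0.
  move=> u0; have -> : 0 = \sum_p \sum_(q | P p q) 0 :> C.
    by rewrite big1 // => p _; rewrite big1.
  under eq_fun do rewrite toC_sum; apply: flim_sum => p _.
  under eq_fun do rewrite toC_sum; apply: flim_sum => q pq.
  by apply: toC_nm; apply: u0.
have etl : flim \oo (fun k => toC (et k)) 0.
  apply: (sum0 (fun p q => q != p) (fun p q k => seqA k p q)) => p q qp.
  by apply: seqA_off; rewrite eq_sym.
have del : flim \oo (fun k => toC (de k)) 0.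
  apply: (sum0 (fun _ _ => true) (fun p q k => E k p q)) => p q _.
  by have := chol_error_cvg0 p q; rewrite mxE.
(* The diagonal step is the Cholesky error [E] plus a rotation change of at most [4 |m12|], and
   [|m12| <= et + de]; hence [4 (et + de) + de]. *)
have vP : flim \oo (fun k => toC (4 * et k + 5 * de k)) 0.
  under eq_fun do rewrite toCD 2!toCM.
  have := flimD (flimM (@flim_cst R \oo _ (toC 4)) etl) (flimM (@flim_cst R \oo _ (toC 5)) del).
  by rewrite !mulr0 addr0 => ul; apply: ul.
have de0 k p : 0 <= \sum_q nm (E k p q) by apply: sumr_ge0 => q _; apply: nm_ge0.
have deP k p q : nm (E k p q) <= de k.
  rewrite /de (bigD1 p) //= (bigD1 q) //= -addrA lerDl addr_ge0 //.
    by apply: sumr_ge0 => ? _; apply: nm_ge0.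
  by apply: sumr_ge0 => ? _.
have et0 k : 0 <= et k by repeat (apply: sumr_ge0 => ? _); apply: nm_ge0.
have etP k p q : p != q -> nm (seqA k p q) <= et k.
  move=> pq; rewrite /et (bigD1 p) //= (bigD1 q) 1?eq_sym //= -addrA lerDl addr_ge0 //.
    by apply: sumr_ge0 => ? _; apply: nm_ge0.
  by repeat (apply: sumr_ge0 => ? _); apply: nm_ge0.
apply: (@flim_squeeze _ _ _ _ _ 1) vP => k; rewrite mul1r nm_toC.
apply: le_trans (ler_norm _); have nij := piv_neq piv_lt k.
have d0 : 0 <= de k by apply: sumr_ge0.
have [[a ->]|o] := pivot_indexP (i k) (j k) r; last first.
  rewrite seqA_step // embed2_mul // cong_embed2_out // subrr nm0.
  by have := et0 k; lra.
have ME b c : jacM A B piv k b c =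
    seqA k (pivot_index (i k) (j k) b) (pivot_index (i k) (j k) c) +
    E k (pivot_index (i k) (j k) b) (pivot_index (i k) (j k) c).
  by rewrite /E [in RHS]mxE [X in _ + (_ + X)]mxE addrCA subrr addr0 -!pivsubE pivsub_cong.
have M01 : nm (jacM A B piv k c0 c1) <= et k + de k.
  rewrite ME; apply: le_trans (nmD _ _) _; apply: lerD (deP _ _ _).
  by apply: etP.
have [J0 J1] := Jhat_diag_bound (jacM_herm hA pB piv_lt k).
have JB : nm (seqA k.+1 (pivot_index (i k) (j k) a) (pivot_index (i k) (j k) a) -
     jacM A B piv k a a) <= 4 * nm (jacM A B piv k c0 c1).
  rewrite -pivsubE pivsub_seqA //.
  by move: a; apply: ord2P.
have -> : seqA k.+1 (pivot_index (i k) (j k) a) (pivot_index (i k) (j k) a) -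
    seqA k (pivot_index (i k) (j k) a) (pivot_index (i k) (j k) a) =
   (seqA k.+1 (pivot_index (i k) (j k) a) (pivot_index (i k) (j k) a) -
     jacM A B piv k a a) + E k (pivot_index (i k) (j k) a) (pivot_index (i k) (j k) a).
  by rewrite ME; ring.
apply: le_trans (nmD _ _) _.
by have := deP k (pivot_index (i k) (j k) a) (pivot_index (i k) (j k) a); lra.
Qed.

Lemma pencil_diag_cvg0 r : flim \oo (fun k => (pencil A B).[seqA k r r]) 0.
Proof.
have detB : flim \oo (fun k => \det (seqB k)) 1.
  by rewrite -(det1 _ n); apply: mlim_det seqB_cvg1.
have D : flim \oo (fun k => \det (seqA k r r *: seqB k - seqA k) * \det B) 0.
  rewrite -(mul0r (\det B)); apply: flimM (flim_cst _).
  apply: flim_oo_ultra => phi phiP G UG ooG.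
  have [M AM] := seqA_bounded A hB pB piv_lt.
  have [a aP] : exists a, mlim (F := G) (fun m => seqA (phi m)) a.
    by apply: ultra_mlim; exists M => m p q; apply: AM.
  have phi_oo N : G [set m | (N <= phi m)%N].
    by apply: ooG; exists N => // m /= Nm; apply: leq_trans (phiP m).
  have bP : mlim (F := G) (fun m => seqB (phi m)) 1%:M.
    by move=> p q; exact: (flim_subseq phi_oo (seqB_cvg1 p q)).
  have a0 p q : p != q -> a p q = 0.
    move=> pq; apply: (flim_unique (aP p q)).
    exact: (flim_subseq phi_oo (seqA_off pq)).
  (* For a diagonal limit [a], row [r] of [a r r - a] is zero. *)
  have -> : 0 = \det (a r r *: 1%:M - a).
    rewrite (expand_det_row _ r) big1 // => q _; rewrite !mxE.
    case: (eqVneq r q) => [<-|rq]; first by rewrite mulr1 subrr mul0r.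
    by rewrite mulr0 (a0 r q rq) subrr mul0r.
  apply: mlim_det => p q; rewrite !mxE; under eq_fun do rewrite mxE [X in _ + X]mxE mxE.
  apply: flimB (aP p q); apply: flimM (aP r r) _.
  by have := bP p q; rewrite mxE.
(* Eventually [|det B_k| > 1/2], so a product below [e / 2] leaves the polynomial value below
   [e]. *)
move=> e e0; have e2 : 0 < e / 2 by lra.
have h2 : 0 < 1 / 2 :> R by lra.
apply: filterS2 (D _ e2) (detB _ h2) => k /=; rewrite !subr0.
have := pencil_cong A B (factor A B piv k) (seqA k r r).
rewrite -seqA_factor // -seqB_factor // => ->; rewrite nmM => h b.
have := nm_triangle 1 (\det (seqB k)) 0; rewrite !subr0 nm1 (nmB 1) => t.
have := nm_ge0 (pencil A B).[seqA k r r]; nra.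
Qed.

Lemma diag_cvg r : exists l, flim \oo (fun k => seqA k r r) l.
Proof.
have p0 := pencil_neq0 A (posdef_unit pB).
have [rs e] := closed_field_poly_normal (pencil A B).
have : lead_coef (pencil A B) != 0 by rewrite lead_coef_eq0.
move: e; move: (lead_coef _) => c e lc.
apply: (cluster_cvg (rs := rs)) (diag_step_cvg0 r).
have -> : (fun k => \prod_(z <- rs) (seqA k r r - z)) =
   (fun k => c^-1 * (pencil A B).[seqA k r r]).
  apply/funext => k; rewrite [in RHS]e hornerZ mulKf // horner_prod.
  by apply: eq_bigr => z _; rewrite !hornerE.
by rewrite -(mulr0 c^-1); apply: flimM (flim_cst _) (pencil_diag_cvg0 r).
Qed.

Lemma mlim_mx_cvg (M : nat -> 'M[C]_n) L : mlim (F := \oo) M L -> mx_cvg M L.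
Proof.
move=> ML e e0.
have [N _ NP] := filter_forall _ (fun rs : 'I_n * 'I_n => ML rs.1 rs.2 e e0).
exists N => k Nk r s.
by rewrite nmE toC_lt; apply: (NP k Nk (r, s)).
Qed.

(** Multiplicities come from evaluating the congruence identity at a fixed [x] and taking its limit
    in two ways: one side tends to the pencil at [x], the other to [det B * det (x - Lambda)]. *)
Lemma cj_convergence : exists d : 'rV[C]_n, pencil_eigs A B d /\
  mx_cvg seqA (diag_mx d) /\ mx_cvg seqB 1%:M.
Proof.
have [l lP] := choice diag_cvg.
exists (\row_r l r); set d := \row_r l r.
have Ad : mlim (F := \oo) seqA (diag_mx d).
  move=> r s; rewrite mxE; case: (eqVneq r s) => [<-|/seqA_off//].
  by rewrite mulr1n mxE; apply: lP.
split; last by split; apply: mlim_mx_cvg => //; apply: seqB_cvg1.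
apply: poly_eval_inj => x; rewrite -/(pencil A B).
have h1 : flim \oo (fun k => \det (seqB k) * (pencil A B).[x]) (1 * (pencil A B).[x]).
  apply: flimM (flim_cst _); rewrite -(det1 _ n); apply: mlim_det seqB_cvg1.
have h2 : flim \oo (fun k => \det (seqB k) * (pencil A B).[x])
    (\det (x *: 1%:M - diag_mx d) * \det B).
  have -> : (fun k => \det (seqB k) * (pencil A B).[x]) =
      (fun k => \det (x *: seqB k - seqA k) * \det B).
    by apply/funext => k; rewrite seqB_factor // seqA_factor // pencil_cong.
  apply: flimM (flim_cst _); apply: mlim_det => p q; rewrite !mxE.
  under eq_fun do rewrite mxE [X in _ + X]mxE mxE.
  apply: flimB; last by have := Ad p q; rewrite !mxE.
  by apply: flimM (flim_cst _) _; have := seqB_cvg1 p q; rewrite mxE.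
rewrite -[LHS]mul1r (flim_unique h1 h2) hornerZ mulrC; congr (_ * _).
have -> : x *: 1%:M - diag_mx d = diag_mx (\row_r (x - d 0 r)).
  apply/matrixP => p q; rewrite !mxE; case: eqP => [->|_].
    by rewrite mulr1 !mulr1n.
  by rewrite mulr0 !mulr0n subr0.
rewrite det_diag horner_prod; apply: eq_bigr => r _.
by rewrite !hornerE mxE.
Qed.

End Convergence.

Theorem theorem4p1 (R : realType) (n : nat) (A B : 'M[R[i]]_n)
    (O : seq ('I_n * 'I_n)) (dflt : 'I_n * 'I_n) :
  (2 <= n)%N -> herm_mx A -> herm_mx B -> posdef_mx B -> C_sg O ->
  exists d : 'rV[R[i]]_n,
    pencil_eigs A B d /\
    mx_cvg (fun k => (cj_seq A B (cyc_strategy O dflt) k).1) (diag_mx d) /\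
    mx_cvg (fun k => (cj_seq A B (cyc_strategy O dflt) k).2) 1%:M.
Proof.
move=> n2 hA hB pB CO.
have [T fT] := forcing_window R dflt n2 CO.
apply: cj_convergence fT => // k; apply: (ordering_lt (proj1 CO)).
by rewrite mem_nth // size_ordering ?ltn_pmod ?Npairs_gt0 //; apply: (proj1 CO).
Qed.
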